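(* Let $G$ be a $2$-connected strictly metrizable graph with no compliant edges. Then $G$ is either $K_5$, or $W_5$, or a subdivision of one of the graphs $K_{2,3}$, $K_4$, $W_4$, $W_4'$.
   Context: All graphs are finite and simple. A consistent path system in a graph $G=(V,E)$ is a collection $\mathcal{P}$ of paths in $G$ such that (1) for every pair $u,v\in V$ there is exactly one $uv$-path $P_{u,v}$ in $\mathcal{P}$, and $P_{v,u}$ is $P_{u,v}$ reversed; (2) the non-empty intersection of any two paths in $\mathcal{P}$ is a path in $\mathcal{P}$. $\mathcal{P}$ is strictly metric if there is $w:E\to\mathbb{R}_{>0}$ such that each path in $\mathcal{P}$ is the unique $w$-shortest path between its endpoints; $G$ is strictly metrizable if every consistent path system in $G$ is strictly metric. A flat path in $G$ is a path all of whose internal vertices have degree $2$ in $G$. An edge $xy$ is compliant if $x$ and $y$ are also connected by another flat path in $G$ (besides the edge $xy$). $W_n$ denotes the wheel consisting of a cycle on $n$ vertices plus a central vertex adjacent to all of them (so $W_4$ has $5$ vertices and $W_5$ has $6$). $W_4'$ is the $5$-vertex graph with $9$ edges, i.e. $W_4$ with one additional chord joining two opposite rim vertices ($K_5$ minus an edge). *)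

(* Defs.v *)
From HB Require Import structures.
From mathcomp Require Import all_boot all_order all_algebra.
From mathcomp Require Import reals.

Set Implicit Arguments.
Unset Strict Implicit.
Unset Printing Implicit Defensive.

Import Order.TTheory GRing.Theory Num.Theory.

Record sgraph := SGraph {
  vertex :> finType;
  adj : rel vertex;
  adj_sym : symmetric adj;
  adj_irr : irreflexive adj
}.

Definition degree (G : sgraph) (x : G) : nat := #|[set y | adj x y]|.

Definition isomorphic (G H : sgraph) : Prop :=
  exists2 f : G -> H, bijective f & {mono f : x y / adj x y}.

Definition connected_off (G : sgraph) (S : {set G}) : Prop :=
  forall x y : G, x \notin S -> y \notin S ->
    connect [rel u v | [&& adj u v, u \notin S & v \notin S]] x y.

Definition k_connected (k : nat) (G : sgraph) : Prop :=
  k < #|G| /\ (forall S : {set G}, #|S| < k -> connected_off S).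

(* A [u]-[v] path is given by the list of all its vertices, both ends
   included; the only [u]-[u] path is [[:: u]]. *)
Definition upath (G : sgraph) (u v : G) (p : seq G) : bool :=
  [&& p != [::], head u p == u, last v p == v, sorted (@adj G) p & uniq p].

Definition steps (T : Type) (p : seq T) : seq (T * T) := zip p (behead p).

Definition edge_on (G : sgraph) (p : seq G) (u v : G) : bool :=
  ((u, v) \in steps p) || ((v, u) \in steps p).

Definition flat_path (G : sgraph) (u v : G) (p : seq G) : Prop :=
  upath u v p /\
  (forall z, z \in p -> z != u -> z != v -> degree z = 2).

Definition compliant (G : sgraph) (x y : G) : Prop :=
  adj x y /\ (exists2 p : seq G, flat_path x y p & p <> [:: x; y]).

(* The collection of paths is presented as the family of its members
   [P u v], the unique [u]-[v] path of the collection. Intersections are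
   intersections of subgraphs: both vertices and edges are intersected. *)
Definition consistent (G : sgraph) (P : G -> G -> seq G) : Prop :=
  [/\ forall u v, upath u v (P u v),
      forall u v, P v u = rev (P u v)
    & forall a b c d, (exists z, z \in P a b /\ z \in P c d) ->
        exists x y,
          (forall z, (z \in P x y) = (z \in P a b) && (z \in P c d)) /\
          (forall u v, edge_on (P x y) u v =
                       edge_on (P a b) u v && edge_on (P c d) u v)].

(* Only the values of [w] on pairs of adjacent vertices matter. *)
Definition weight (R : realType) (G : sgraph) (w : G -> G -> R) (p : seq G) : R :=
  (\sum_(s <- steps p) w s.1 s.2)%R.

Definition strictly_metric (R : realType) (G : sgraph)
    (P : G -> G -> seq G) : Prop :=
  exists w : G -> G -> R,
    [/\ forall x y, w x y = w y x,
        forall x y, adj x y -> (0 < w x y)%R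
      & forall u v q, upath u v q -> q <> P u v ->
          (weight w (P u v) < weight w q)%R].

Definition strictly_metrizable (R : realType) (G : sgraph) : Prop :=
  forall P : G -> G -> seq G, consistent P -> strictly_metric R P.

(* [G] is obtained from [H] by replacing each edge [x y] by a path [p x y] of
   length at least one, these paths being pairwise internally disjoint; [f]
   embeds the vertices of [H] as branch vertices. [H] is a subdivision of
   itself. *)
Definition subdivision (H G : sgraph) : Prop :=
  exists (f : H -> G) (p : H -> H -> seq G),
    injective f /\
    [/\ forall x y, adj x y -> upath (f x) (f y) (p x y),
        forall x y, adj x y -> p y x = rev (p x y),
        forall x y z, adj x y -> f z \in p x y -> z = x \/ z = y,
        forall x y x' y' z, adj x y -> adj x' y' ->
          z \in p x y -> z \in p x' y' -> (forall t, z <> f t) ->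
          (x' = x /\ y' = y) \/ (x' = y /\ y' = x)
      & (forall z, (exists x, z = f x) \/
                   (exists x y, adj x y /\ z \in p x y)) /\
        (forall u v, adj u v -> exists x y, adj x y /\ edge_on (p x y) u v)].

Lemma complete_sym n : symmetric (fun i j : 'I_n => i != j).
Proof. by move=> i j; rewrite eq_sym. Qed.

Lemma complete_irr n : irreflexive (fun i j : 'I_n => i != j).
Proof. by move=> i; rewrite eqxx. Qed.

Definition complete (n : nat) : sgraph :=
  SGraph (@complete_sym n) (@complete_irr n).

Definition is_left (A B : Type) (x : A + B) : bool :=
  if x is inl _ then true else false.

Definition bipartite_adj m n (x y : 'I_m + 'I_n) : bool :=
  is_left x != is_left y.

Lemma bipartite_sym m n : symmetric (@bipartite_adj m n).
Proof. by move=> x y; rewrite /bipartite_adj eq_sym. Qed.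

Lemma bipartite_irr m n : irreflexive (@bipartite_adj m n).
Proof. by move=> x; rewrite /bipartite_adj eqxx. Qed.

Definition complete_bipartite (m n : nat) : sgraph :=
  SGraph (@bipartite_sym m n) (@bipartite_irr m n).

(* [None] is the hub, [ordS] the cyclic successor on the rim; this is the
   wheel with [n] spokes for [n >= 3]. *)
Definition wheel_adj n (x y : option 'I_n) : bool :=
  match x, y with
  | None, None => false
  | Some i, Some j => (i != j) && ((j == ordS i) || (i == ordS j))
  | _, _ => true
  end.

Lemma wheel_sym n : symmetric (@wheel_adj n).
Proof. by move=> [i|] [j|] //=; rewrite eq_sym orbC. Qed.

Lemma wheel_irr n : irreflexive (@wheel_adj n).
Proof. by move=> [i|] //=; rewrite eqxx. Qed.

Definition wheel (n : nat) : sgraph := SGraph (@wheel_sym n) (@wheel_irr n).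

Definition add_edge_adj (G : sgraph) (a b x y : G) : bool :=
  adj x y ||
  (a != b) && ((x == a) && (y == b) || (x == b) && (y == a)).

Lemma add_edge_sym (G : sgraph) (a b : G) : symmetric (add_edge_adj a b).
Proof.
move=> x y; rewrite /add_edge_adj adj_sym (andbC (x == b)) (andbC (x == a)).
by rewrite [X in _ && X]orbC.
Qed.

Lemma add_edge_irr (G : sgraph) (a b : G) : irreflexive (add_edge_adj a b).
Proof.
move=> x; rewrite /add_edge_adj adj_irr /= (andbC (x == b)) orbb.
by case: (x =P a) => [->|_]; rewrite ?andbF // andNb.
Qed.

Definition add_edge (G : sgraph) (a b : G) : sgraph :=
  SGraph (add_edge_sym a b) (add_edge_irr a b).

Definition rim4 (i : 'I_4) : wheel 4 := Some i.

Definition wheel4' : sgraph :=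
  add_edge (rim4 (@Ordinal 4 0 isT)) (rim4 (@Ordinal 4 2 isT)).

(* Main.v *)
Require Import Defs.
From mathcomp Require Import all_boot all_order all_algebra.
From mathcomp Require Import reals.
From mathcomp Require Import zify.

Set Implicit Arguments.
Unset Strict Implicit.
Unset Printing Implicit Defensive.

Import Order.TTheory GRing.Theory Num.Theory.

(** A consistent path system that is not strictly metric survives the operations
    that lead from a graph to any connected graph in which it is a topological
    minor (subdividing an edge, adding a pendant vertex, adding edges), so
    strict metrizability can be refuted by a forbidden topological minor. Seven
    small graphs are forbidden by an explicit path system together with a family
    of competing paths having in total the same edges.

    Conversely, take a subgraph [S] of [G] that is a subdivision of a small graph
    [H], with as many vertices as possible. If [S] is not all of [G], then
    2-connectivity gives an ear of [S]. If its ends do not lie on a common branch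
    of [S], then [G] contains an explicit extension of [H]. Otherwise maximality
    and the absence of compliant edges produce two parallel paths of length at
    least two that replace a segment of the branch, again an explicit extension
    of [H]. Starting from a theta graph, this leads to [K4], [W4], [W4'], [W5]
    and [K5], and every other extension contains a forbidden graph; a proper
    subdivision of [W5] or [K5] does, too. *)

(** * Path systems *)

(** Non-metrizability is carried by a path system together with its own edge relation, which may be
    smaller than adjacency and whose edges may at first be absent from [G]. Each enlargement
    preserves it because a weight on the larger graph induces one on the smaller. The converse is a
    finite check because an ear whose ends lie on no common branch has finitely many positions
    relative to [H], whatever the lengths of the branches; small multigraphs with lower bounds on
    lengths record all that matters. Ears on a single branch are not bounded in this way. Compliance
    always enters in the same form: a path of length at least two parallel to an edge has an
    interior vertex of degree other than two. *)

Lemma cat_uniq_mid (T : eqType) (s : T) p1 p2 q1 q2 :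
  uniq (p1 ++ s :: p2) -> p1 ++ s :: p2 = q1 ++ s :: q2 -> p1 = q1 /\ p2 = q2.
Proof.
elim: p1 q1 => [|a p1 IH] [|b q1] //=.
- by move=> _ [->].
- move=> /andP[sN _] [sb E]; case/negP: sN.
  by rewrite E sb mem_cat mem_head orbT.
- move=> /andP[aN _] [E1 E2]; case/negP: aN.
  by rewrite E1 mem_cat mem_head orbT.
- by move=> /andP[_ U] [-> E]; case: (IH q1 U E) => -> ->.
Qed.

Lemma mem_split (T : eqType) (x : T) s :
  x \in s -> exists p1 p2, s = p1 ++ x :: p2.
Proof. by case/splitPr=> p1 p2; exists p1, p2. Qed.

Section PathSystems.
Variable T : finType.

(** [N u v] is the route from [u] to [v] without its starting vertex, so that [path r u (N u v)]
    applies directly. Closure under suffixes together with reversal gives closure under subpaths,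
    from which consistency follows. [ps_edge] makes every edge its own route, which subdividing it
    relies on. *)
Record path_system (A : {set T}) (r : rel T) (N : T -> T -> seq T) : Prop :=
  PathSystem {
  ps_supp : forall u v, r u v -> (u \in A) && (v \in A);
  ps_sym : symmetric r;
  ps_path : {in A &, forall u v, path r u (N u v)};
  ps_last : {in A &, forall u v, last u (N u v) = v};
  ps_uniq : {in A &, forall u v, uniq (u :: N u v)};
  ps_sub : {in A &, forall u v, {subset N u v <= A}};
  ps_rev : {in A &, forall u v, u :: N u v = rev (v :: N v u)};
  ps_suf : {in A &, forall u v s p, N u v = s :: p -> N s v = p};
  ps_edge : {in A &, forall u v, r u v -> N u v = [:: v]} }.

Section Basic.
Variables (A : {set T}) (r : rel T) (N : T -> T -> seq T).
Hypothesis ps : path_system A r N.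

Lemma ps_suffix u v p1 s p2 :
  u \in A -> v \in A -> N u v = p1 ++ s :: p2 -> N s v = p2.
Proof.
elim: p1 u => [|a p1 IH] u uA vA E; first exact: (ps_suf ps uA vA E).
have aA : a \in A by apply: (ps_sub ps uA vA); rewrite E mem_head.
apply: (IH a) => //; exact: (ps_suf ps uA vA E).
Qed.

(** Read backwards, a prefix is a suffix of the reversed route. *)
Lemma ps_prefix u v p1 s p2 :
  u \in A -> v \in A -> N u v = p1 ++ s :: p2 -> N u s = rcons p1 s.
Proof.
move=> uA vA E.
have sA : s \in A by apply: (ps_sub ps uA vA); rewrite E mem_cat mem_head orbT.
have L := ps_last ps uA vA; have U := ps_uniq ps uA vA.
case/lastP: p2 E => [|p2 w] E.
  by move: L; rewrite {1}E last_cat /= => sv; rewrite {1}sv E cats1.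
have wv : w = v by rewrite -L E last_cat /= last_rcons.
have := ps_rev ps vA uA; rewrite E wv.
rewrite rev_cons rev_cat rev_cons rev_rcons /= -!cats1 -!catA /= => -[E2].
have E3 := ps_suffix vA uA E2.
have := ps_rev ps uA sA; rewrite E3.
by rewrite rev_cons rev_cat /= revK => -[->]; rewrite cats1.
Qed.

Lemma ps_refl u : u \in A -> N u u = [::].
Proof.
move=> uA; have := ps_last ps uA uA; have := ps_uniq ps uA uA.
case: (N u u) => //= a p /andP[uN _] E; case/negP: uN.
by rewrite -{1}E mem_last.
Qed.

End Basic.

Section AddVertex.
Variables (A : {set T}) (z : T) (r : rel T) (Q : T -> T -> seq T) (L : T -> seq T).
Hypothesis zA : z \notin A.
Hypothesis r_supp : forall u v, r u v -> (u \in z |: A) && (v \in z |: A).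
Hypothesis r_irr : ~~ r z z.
Hypothesis r_sym : symmetric r.
Hypothesis Q_path : {in A &, forall u v, path r u (Q u v)}.
Hypothesis Q_last : {in A &, forall u v, last u (Q u v) = v}.
Hypothesis Q_uniq : {in A &, forall u v, uniq (u :: Q u v)}.
Hypothesis Q_sub : {in A &, forall u v, {subset Q u v <= z |: A}}.
Hypothesis Q_rev : {in A &, forall u v, u :: Q u v = rev (v :: Q v u)}.
Hypothesis Q_suf : {in A &, forall u v s p, Q u v = s :: p -> s \in A -> Q s v = p}.
Hypothesis Q_edge : {in A &, forall u v, r u v -> Q u v = [:: v]}.
Hypothesis Q_new : {in A &, forall u v p, Q u v = z :: p -> p = L v}.
Hypothesis L_path : {in A, forall v, path r z (L v)}.
Hypothesis L_last : {in A, forall v, last z (L v) = v}.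
Hypothesis L_uniq : {in A, forall v, uniq (L v)}.
Hypothesis L_sub : {in A, forall v, {subset L v <= A}}.
Hypothesis L_suf : {in A, forall v s p, L v = s :: p -> Q s v = p}.
Hypothesis L_pre : {in A, forall v p1 t p2, L v = p1 ++ t :: p2 -> L t = rcons p1 t}.
Hypothesis L_edge : {in A, forall v, r z v -> L v = [:: v]}.

(** Common frame for pendant and subdividing vertices: [Q] holds the routes between old vertices,
    possibly through [z], and [L v] continues from [z] to [v]. Routes that end in [z] are obtained
    by reversal. *)
Definition add_vertex u v :=
  if u == z then if v == z then [::] else L v
  else if v == z then behead (rev (z :: L u)) else Q u v.

Lemma add_vertex_old : {in A &, add_vertex =2 Q}.
Proof.
move=> u v uA vA; rewrite /add_vertex.
by case: eqP uA => [->|_ _]; [rewrite (negPf zA)|case: eqP vA => // ->; rewrite (negPf zA)].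
Qed.

Let neqz u : u \in A -> (u == z) = false.
Proof. by move=> uA; apply: contraNF zA => /eqP <-. Qed.

Lemma add_vertex_rev_z u : u \in A -> u :: add_vertex u z = rev (z :: L u).
Proof.
move=> uA; rewrite /add_vertex (neqz uA) eqxx.
have := L_last uA; case/lastP: (L u) => [/= E|p w].
  by move: zA; rewrite E uA.
by rewrite last_rcons => ->; rewrite rev_cons rev_rcons.
Qed.

Lemma add_vertex_from_z u : u \in A -> add_vertex z u = L u.
Proof. by move=> uA; rewrite /add_vertex eqxx (neqz uA). Qed.

Lemma add_vertex_zz : add_vertex z z = [::].
Proof. by rewrite /add_vertex eqxx. Qed.

Lemma add_vertex_system : path_system (z |: A) r add_vertex.
Proof.
have zL v : v \in A -> z \notin L v.
  by move=> vA; apply: contra zA => /(L_sub vA).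
have revpath u : u \in A -> path r u (add_vertex u z) /\ last u (add_vertex u z) = z.
  move=> uA; have E := add_vertex_rev_z uA.
  have sP : sorted r (u :: add_vertex u z).
    rewrite E rev_sorted /=.
    rewrite (eq_path (e' := r)); first exact: L_path.
    by move=> a b; rewrite r_sym.
  by split=> //; rewrite -[LHS]/(last u (u :: add_vertex u z)) E rev_cons last_rcons.
split=> //.
- move=> u v; rewrite !inE => /predU1P[->|uA] /predU1P[->|vA].
  + by rewrite add_vertex_zz.
  + by rewrite add_vertex_from_z //; exact: L_path.
  + by case: (revpath u uA).
  + by rewrite add_vertex_old //; exact: Q_path.
- move=> u v; rewrite !inE => /predU1P[->|uA] /predU1P[->|vA].
  + by rewrite add_vertex_zz.
  + by rewrite add_vertex_from_z //; exact: L_last.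
  + by case: (revpath u uA).
  + by rewrite add_vertex_old //; exact: Q_last.
- move=> u v; rewrite !inE => /predU1P[->|uA] /predU1P[->|vA].
  + by rewrite add_vertex_zz.
  + by rewrite add_vertex_from_z //= zL // L_uniq.
  + by rewrite add_vertex_rev_z // rev_uniq /= zL // L_uniq.
  + by rewrite add_vertex_old //; exact: Q_uniq.
- move=> u v; rewrite !inE => /predU1P[->|uA] /predU1P[->|vA].
  + by rewrite add_vertex_zz.
  + by rewrite add_vertex_from_z // => w /(L_sub vA); rewrite inE orbC => ->.
  + move=> w Hw; have : w \in u :: add_vertex u z by rewrite inE Hw orbT.
    rewrite add_vertex_rev_z // mem_rev !inE => /orP[->//|/(L_sub uA) ->].
    by rewrite orbT.
  + by rewrite add_vertex_old //; exact: Q_sub.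
- move=> u v; rewrite !inE => /predU1P[->|uA] /predU1P[->|vA].
  + by rewrite add_vertex_zz.
  + by rewrite add_vertex_rev_z // revK add_vertex_from_z.
  + by rewrite add_vertex_rev_z // add_vertex_from_z.
  + by rewrite !add_vertex_old //; exact: Q_rev.
- move=> u v; rewrite !inE => /predU1P[->|uA] /predU1P[->|vA] s p.
  + by rewrite add_vertex_zz.
  + rewrite add_vertex_from_z // => E.
    have sA : s \in A by apply: (L_sub vA); rewrite E mem_head.
    by rewrite add_vertex_old //; apply: L_suf.
  + move=> E; have := add_vertex_rev_z uA; rewrite E => /(congr1 rev).
    rewrite revK rev_cons rev_cons.
    case/lastP: p E => [|p w] E.
      by rewrite /= => -[-> _]; rewrite add_vertex_zz.
    rewrite rev_rcons /= => -[wz]; rewrite -cats1 cat_rcons => LE.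
    have sA : s \in A by apply: (L_sub uA); rewrite -LE mem_cat mem_head orbT.
    have := add_vertex_rev_z sA; rewrite (L_pre uA (esym LE)).
    by rewrite rev_cons rev_rcons revK /= => -[->]; rewrite wz.
  + rewrite add_vertex_old // => E.
    have : s \in z |: A by apply: (Q_sub uA vA); rewrite E mem_head.
    rewrite !inE => /predU1P[sz|sA].
      by rewrite sz add_vertex_from_z //; rewrite sz in E; rewrite (Q_new uA vA E).
    by rewrite add_vertex_old // (Q_suf uA vA E).
- move=> u v; rewrite !inE => /predU1P[->|uA] /predU1P[->|vA].
  + by rewrite (negPf r_irr).
  + by rewrite add_vertex_from_z //; exact: L_edge.
  + rewrite r_sym => /(L_edge uA) E.
    by have := add_vertex_rev_z uA; rewrite E => -[->].
  + by rewrite add_vertex_old //; exact: Q_edge.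
Qed.

End AddVertex.
End PathSystems.

(** * Pendant vertices and subdivided edges *)

Section Pendant.
Variables (T : finType) (A : {set T}) (r : rel T) (N : T -> T -> seq T).
Hypothesis ps : path_system A r N.
Variables (x z : T).
Hypotheses (xA : x \in A) (zA : z \notin A).

Definition pendant_rel : rel T :=
  fun a b => r a b || (a == x) && (b == z) || (a == z) && (b == x).

Lemma pendant_system :
  path_system (z |: A) pendant_rel (add_vertex z N (fun v => x :: N x v)).
Proof.
have xz : x != z by apply: contraNneq zA => <-.
have rA a b : a \in A -> b \in A -> pendant_rel a b = r a b.
  move=> aA bA; have nz w : w \in A -> (w == z) = false.
    by move=> wA; apply: contraNF zA => /eqP <-.
  by rewrite /pendant_rel (nz a) ?(nz b) // !(andbF, orbF).
have sub a p : path r a p -> path pendant_rel a p.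
  by apply: sub_path => b c; rewrite /pendant_rel => ->.
have rz a : r z a = false.
  by apply: contraNF zA => /(ps_supp ps) /andP[].
apply: add_vertex_system => //.
- move=> u v /orP[/orP[/(ps_supp ps)|]|]; rewrite !inE.
  + by case/andP=> -> ->; rewrite !orbT.
  + by case/andP=> /eqP-> /eqP->; rewrite xA eqxx orbT.
  + by case/andP=> /eqP-> /eqP->; rewrite xA eqxx orbT.
- by rewrite /pendant_rel rz eqxx andbT eq_sym (negPf xz).
- move=> a b; rewrite /pendant_rel (ps_sym ps) -!orbA; congr orb.
  by rewrite orbC (andbC (a == z)) (andbC (a == x)).
- by move=> u v uA vA; apply: sub; apply: (ps_path ps).
- exact: (ps_last ps).
- exact: (ps_uniq ps).
- by move=> u v uA vA w /(ps_sub ps uA vA); rewrite inE orbC => ->.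
- exact: (ps_rev ps).
- by move=> u v uA vA s p E _; apply: (ps_suf ps uA vA E).
- by move=> u v uA vA; rewrite rA //; apply: (ps_edge ps).
- move=> u v uA vA p E; case/negP: zA.
  by apply: (ps_sub ps uA vA); rewrite E mem_head.
- move=> v vA /=; apply/andP; split; first by rewrite /pendant_rel !eqxx orbT.
  by apply: sub; apply: (ps_path ps).
- by move=> v vA /=; apply: (ps_last ps).
- by move=> v vA; apply: (ps_uniq ps).
- by move=> v vA w; rewrite inE => /predU1P[->//|]; apply: (ps_sub ps).
- by move=> v vA s p [<- <-].
- move=> v vA [|a p1] t p2 [].
    by move=> <- _; rewrite (ps_refl ps).
  by move=> <- /(ps_prefix ps xA vA) ->.
- move=> v vA; rewrite /pendant_rel rz eqxx (eq_sym z) (negPf xz) /= => /eqP->.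
  by rewrite (ps_refl ps).
Qed.

End Pendant.

Section Subdivide.
Variables (T : finType) (x y z : T).
Hypotheses (xy : x != y).

Definition at_xy : rel T :=
  fun a b => (a == x) && (b == y) || (a == y) && (b == x).

Lemma at_xyC : symmetric at_xy.
Proof. by move=> a b; rewrite /at_xy orbC (andbC (a == x)) (andbC (a == y)). Qed.

Fixpoint insert_mid (a : T) (p : seq T) : seq T :=
  if p is b :: p' then
    if at_xy a b then [:: z, b & insert_mid b p'] else b :: insert_mid b p'
  else [::].

Lemma insert_mid_cat a p q :
  insert_mid a (p ++ q) = insert_mid a p ++ insert_mid (last a p) q.
Proof. by elim: p a => //= b p IH a; case: ifP => _; rewrite IH. Qed.

Lemma insert_mid_last a p : last a (insert_mid a p) = last a p.
Proof. by elim: p a => //= b p IH a; case: ifP => _ /=; rewrite IH. Qed.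

Lemma insert_mid_rev a p b q :
  a :: p = rev (b :: q) -> a :: insert_mid a p = rev (b :: insert_mid b q).
Proof.
elim: q a b p => [|c q IH] a b p.
  by move=> [-> ->].
rewrite rev_cons; case/lastP: p => [|p w].
  by move/(congr1 size); rewrite size_rcons size_rev.
rewrite -rcons_cons => /rcons_inj[E ->]; have := IH _ _ _ E.
rewrite -cats1 insert_mid_cat /=.
have -> : last a p = c.
  by have := congr1 (last a) E; rewrite rev_cons last_rcons.
rewrite at_xyC; case: ifP => _ H; rewrite -cat_cons H !rev_cons -!cats1 //.
by rewrite -!catA.
Qed.

Lemma insert_mid_id a p : (x \notin a :: p) || (y \notin a :: p) -> insert_mid a p = p.
Proof.
elim: p a => //= b p IH a; rewrite !inE !negb_or => H.
have -> : at_xy a b = false.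
  apply/negbTE; apply: contraTN H; rewrite /at_xy.
  by case/orP=> /andP[/eqP-> /eqP->]; rewrite !eqxx ?andbF.
by rewrite IH // !inE !negb_or; case/orP: H => /andP[_ ->]; rewrite ?orbT.
Qed.

Lemma filter_insert_mid a p : z \notin p -> filter (predC1 z) (insert_mid a p) = p.
Proof.
elim: p a => //= b p IH a; rewrite inE negb_or => /andP[zb zp].
by case: ifP => _ /=; rewrite ?eqxx /= eq_sym zb IH.
Qed.

Lemma mem_insert_mid a p : {subset insert_mid a p <= z :: p}.
Proof.
elim: p a => //= b p IH a w.
have H : w \in b :: insert_mid b p -> w \in z :: b :: p.
  rewrite !inE => /predU1P[->|/IH]; first by rewrite eqxx orbT.
  by rewrite inE => /orP[->|->]; rewrite ?orbT.
by case: ifP => _ //; rewrite inE => /predU1P[->|/H //]; rewrite mem_head.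
Qed.

Lemma insert_mid_uniq a p : z \notin a :: p -> uniq (a :: p) -> uniq (a :: insert_mid a p).
Proof.
elim: p a => //= b p IH a zap /andP[aN /andP[bN U]].
have [az bz pz] : [/\ z != a, z != b & z \notin p].
  by move: zap; rewrite !inE !negb_or => /and3P[].
case: ifP => [ab|_].
  have -> : insert_mid b p = p.
    apply: insert_mid_id; move: ab aN; rewrite /at_xy.
    by case/orP => /andP[/eqP-> /eqP->] ->; rewrite ?orbT.
  rewrite /= !inE !negb_or bz pz bN U eq_sym az /=.
  by move: aN; rewrite inE negb_or => /andP[-> ->].
have := IH b; rewrite inE negb_or bz pz /= bN U => /(_ isT isT) H.
rewrite /= H andbT; apply: contra aN.
rewrite !inE => /predU1P[->|/mem_insert_mid]; first by rewrite eqxx.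
by rewrite inE eq_sym (negPf az) /= => ->; rewrite orbT.
Qed.

Definition subdiv_rel (r : rel T) : rel T := fun a b =>
  [|| r a b && ~~ at_xy a b, (a == z) && ((b == x) || (b == y))
    | (b == z) && ((a == x) || (a == y))].

Lemma insert_mid_path r a p : path r a p -> path (subdiv_rel r) a (insert_mid a p).
Proof.
elim: p a => //= b p IH a /andP[rab /IH H].
case: ifP => ab /=; rewrite H andbT /subdiv_rel ?rab ?ab //=.
rewrite !eqxx /=; move: ab; rewrite /at_xy.
by case/orP => /andP[/eqP-> /eqP->]; rewrite !eqxx ?orbT.
Qed.

Section System.
Variables (A : {set T}) (r : rel T) (N : T -> T -> seq T).
Hypothesis ps : path_system A r N.
Hypotheses (rxy : r x y) (zA : z \notin A).

(* The route from the new vertex [z] leaves through [y] exactly when the old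
   route from [x] does; these are the routes without their starting point. *)
Definition mid_route v := if y \in N x v then N x v else x :: N x v.

Definition subdiv_paths := add_vertex z (fun u v => insert_mid u (N u v)) mid_route.

Let xA : x \in A. Proof. by case/andP: (ps_supp ps rxy). Qed.
Let yA : y \in A. Proof. by case/andP: (ps_supp ps rxy). Qed.
Let Nxy : N x y = [:: y]. Proof. exact: (ps_edge ps). Qed.
Let zN u v : u \in A -> v \in A -> z \notin u :: N u v.
Proof.
move=> uA vA; rewrite inE negb_or; apply/andP; split.
  by apply: contraNneq zA => ->.
by apply: contra zA => /(ps_sub ps uA vA).
Qed.

(** The prefix up to [y] is the route from [x] to [y], hence the single edge [x y]. *)
Lemma mid_route_through v : v \in A -> y \in N x v -> N x v = y :: N y v.
Proof.
move=> vA /mem_split[p1 [p2 E]]; have := ps_prefix ps xA vA E; rewrite Nxy.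
case: p1 E => [|a p1] E; last by move/(congr1 size); rewrite /= size_rcons.
by move=> _; rewrite E (ps_suf ps xA vA E).
Qed.

(** The prefixes of a route from [z] leave [z] on the same side: if [y] lies on the route from [x]
    to [v], it is the first vertex after [x] and lies on every nonempty prefix; otherwise it lies on
    none. Old routes through [z] agree with this choice, since they traverse the edge [x y]. *)
Lemma subdiv_system : path_system (z |: A) (subdiv_rel r) subdiv_paths.
Proof.
have nz w : w \in A -> (w == z) = false.
  by move=> wA; apply: contraNF zA => /eqP <-.
have rz a : r z a = false.
  by apply: contraNF zA => /(ps_supp ps) /andP[].
have zx : (z == x) = false by rewrite eq_sym nz.
have zy : (z == y) = false by rewrite eq_sym nz.
have rS a b : a \in A -> b \in A -> subdiv_rel r a b = r a b && ~~ at_xy a b.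
  by move=> aA bA; rewrite /subdiv_rel (nz a) ?(nz b) //= !orbF.
apply: add_vertex_system => //.
- move=> u v /or3P[/andP[/(ps_supp ps) /andP[uA vA] _]||]; rewrite !inE.
  + by rewrite uA vA !orbT.
  + by case/andP=> /eqP-> /orP[]/eqP->; rewrite ?xA ?yA eqxx orbT.
  + by case/andP=> /eqP-> /orP[]/eqP->; rewrite ?xA ?yA eqxx orbT.
- by rewrite /subdiv_rel rz zx zy /= !andbF.
- by move=> a b; rewrite /subdiv_rel (ps_sym ps) at_xyC; congr orb; rewrite orbC.
- by move=> u v uA vA; apply/insert_mid_path/(ps_path ps).
- by move=> u v uA vA; rewrite insert_mid_last; apply: (ps_last ps).
- by move=> u v uA vA; apply: insert_mid_uniq; [exact: zN|apply: (ps_uniq ps)].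
- move=> u v uA vA w /mem_insert_mid; rewrite !inE => /predU1P[->|].
    by rewrite eqxx.
  by move/(ps_sub ps uA vA) ->; rewrite orbT.
- by move=> u v uA vA; apply: insert_mid_rev; apply: (ps_rev ps).
- move=> u v uA vA s p; case E: (N u v) => [|b q] //=; case: ifP => ab [].
    by move=> <- _; rewrite (negPf zA).
  by move=> <- <- sA; rewrite (ps_suf ps uA vA E).
- move=> u v uA vA; rewrite rS // => /andP[ruv ab].
  by rewrite (ps_edge ps) //= (negPf ab).
- move=> u v uA vA p; case E: (N u v) => [|b q] //=; case: ifP => ab [].
    have Eb := ps_suf ps uA vA E; have U := ps_uniq ps uA vA.
    move=> <-; rewrite /mid_route; case/orP: ab => /andP[/eqP ux /eqP bx];
      rewrite ux bx in E Eb U *.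
      rewrite E mem_head insert_mid_id //.
      by move: U; rewrite E /= => /andP[->].
    rewrite Eb; move: U; rewrite E /= inE negb_or => /andP[/andP[yx yq] _].
    by rewrite (negPf yq) insert_mid_id // !inE !negb_or yx yq orbT.
  by move=> bz; have := zN uA vA; rewrite E bz !inE eqxx !orbT.
- have subP v : v \in A -> y \notin N x v -> path (subdiv_rel r) x (N x v).
    move=> vA yN; rewrite -{1}(@insert_mid_id x (N x v)).
      exact/insert_mid_path/(ps_path ps).
    by rewrite !inE !negb_or (eq_sym y) xy yN orbT.
  move=> v vA; rewrite /mid_route; case: ifP => yN.
    have E := mid_route_through vA yN; rewrite E /= {1}/subdiv_rel !eqxx !orbT /=.
    rewrite -(@insert_mid_id y (N y v)); first exact/insert_mid_path/(ps_path ps).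
    by have := ps_uniq ps xA vA; rewrite E /= => /andP[->].
  by rewrite /= subP ?yN // /subdiv_rel !eqxx !orbT.
- move=> v vA; rewrite /mid_route; case: ifP => yN /=.
    have := ps_last ps xA vA; by rewrite (mid_route_through vA yN).
  exact: (ps_last ps).
- move=> v vA; rewrite /mid_route; have := ps_uniq ps xA vA.
  by case: ifP => // _ /= /andP[].
- move=> v vA; rewrite /mid_route; case: ifP => _; first exact: (ps_sub ps).
  by move=> w; rewrite inE => /predU1P[->//|]; apply: (ps_sub ps).
- move=> v vA s p; have U := ps_uniq ps xA vA.
  rewrite /mid_route; case: ifP => yN.
    rewrite (mid_route_through vA yN) => -[<- <-]; apply: insert_mid_id.
    by move: U; rewrite (mid_route_through vA yN) /= => /andP[->].
  move=> [<- <-]; apply: insert_mid_id.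
  by rewrite !inE !negb_or (eq_sym y) xy yN orbT.
- move=> v vA p1 t p2; rewrite /mid_route; case: ifP => yN.
    move=> E; rewrite (ps_prefix ps xA vA E).
    move: E; rewrite (mid_route_through vA yN).
    case: p1 => [|a p1] [-> _] /=; by rewrite mem_head.
  case: p1 => [|a p1] [<-]; first by rewrite (ps_refl ps).
  move=> E; rewrite (ps_prefix ps xA vA E) ifN //.
  by apply: contraFN yN; rewrite E -cat_rcons mem_cat => ->.
- move=> v vA; rewrite /subdiv_rel rz eqxx (nz v) //= orbF /mid_route.
  by case/orP => /eqP->; rewrite ?(ps_refl ps) // Nxy mem_head.
Qed.

End System.
End Subdivide.

(** * Transfer of path systems to larger graphs *)

Lemma split_first (T : Type) (a : pred T) s :
  has a s -> exists s1 x s2, [/\ s = s1 ++ x :: s2, a x & ~~ has a s1].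
Proof.
elim: s => //= b s IH; case: (boolP (a b)) => [ab _|nab].
  by exists [::], b, s.
by case/IH=> s1 [x [s2 [-> ax n1]]]; exists (b :: s1), x, s2; rewrite /= negb_or nab.
Qed.

Lemma split_last (T : Type) (a : pred T) s :
  has a s -> exists s1 x s2, [/\ s = s1 ++ x :: s2, a x & ~~ has a s2].
Proof.
rewrite -has_rev => /split_first[s1 [x [s2 [E ax n1]]]].
exists (rev s2), x, (rev s1); rewrite has_rev; split=> //.
by rewrite -(revK s) E rev_cat rev_cons cat_rcons.
Qed.

Lemma mem_stepsP (T : eqType) (p : seq T) u v :
  reflect (exists p1 p2, p = p1 ++ [:: u, v & p2]) ((u, v) \in steps p).
Proof.
apply: (iffP idP) => [|[p1 [p2 ->]]]; last first.
  elim: p1 => [|a [|b p1] IH]; first by rewrite mem_head.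
    by rewrite /steps /= !inE eqxx orbT.
  by rewrite /steps /= inE; apply/orP; right; apply: IH.
elim: p => [|a [|b p] IH] //; rewrite /steps /= inE => /predU1P[[-> ->]|].
  by exists [::], p.
by move/IH => [p1 [p2 ->]]; exists (a :: p1), p2.
Qed.

Lemma edge_on_rev (G : sgraph) (p : seq G) u v : edge_on (rev p) u v = edge_on p u v.
Proof.
have H (q : seq G) a b : (a, b) \in steps q -> (b, a) \in steps (rev q).
  case/mem_stepsP=> p1 [p2 ->]; apply/mem_stepsP; exists (rev p2), (rev p1).
  by rewrite rev_cat !rev_cons !cat_rcons.
by apply/idP/idP => /orP[] /H; rewrite ?revK /edge_on => ->; rewrite ?orbT.
Qed.

Section Metric.
Variables (R : realType) (G : sgraph).

Lemma weight1 (w : G -> G -> R) a : weight w [:: a] = 0%R.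
Proof. by rewrite /weight /steps /= big_nil. Qed.

Lemma weight_cons (w : G -> G -> R) a b p :
  weight w (a :: b :: p) = (w a b + weight w (b :: p))%R.
Proof. by rewrite /weight /steps /= big_cons. Qed.

(** Competitors use only edges of [r]. A weight for the whole graph therefore restricts, and edges
    of [G] outside [r] cannot make a system metric. *)
Definition metric_by (A : {set G}) (r : rel G) (N : G -> G -> seq G) (w : G -> G -> R) : Prop :=
  [/\ forall x y, w x y = w y x,
      forall x y, r x y -> (0 < w x y)%R
    & {in A &, forall u v q, path r u q -> last u q = v -> uniq (u :: q) ->
        q <> N u v -> (weight w (u :: N u v) < weight w (u :: q))%R}].

Definition nonmetric (A : {set G}) r N := forall w, ~ metric_by A r N w.

Lemma nonmetric_pendant (A : {set G}) r N x z :
  z \notin A ->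
  nonmetric A r N ->
  nonmetric (z |: A) (pendant_rel r x z) (add_vertex z N (fun v => x :: N x v)).
Proof.
move=> zA nm w [ws wp wN]; apply: (nm w); split=> //.
  by move=> a b rab; apply: wp; rewrite /pendant_rel rab.
move=> u v uA vA q qp ql qu qN.
have := wN u v; rewrite !inE uA vA !orbT => /(_ isT isT q).
rewrite (@add_vertex_old _ A) //; apply=> //.
by apply: sub_path qp => a b rab; rewrite /pendant_rel rab.
Qed.

(** A weight on the subdivided graph pulls back: [x y] receives the sum of its two halves, and
    [insert_mid] then preserves the weight of every path. *)
Lemma nonmetric_subdiv (A : {set G}) r N x y z :
  path_system A r N -> x != y -> r x y -> z \notin A ->
  nonmetric A r N ->
  nonmetric (z |: A) (subdiv_rel x y z r) (subdiv_paths x y z N).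
Proof.
move=> ps xy rxy zA nm w [ws wp wN].
pose w0 a b := if at_xy x y a b then (w x z + w z y)%R else w a b.
have W a p : weight w0 (a :: p) = weight w (a :: insert_mid x y z a p).
  elim: p a => [|b p IH] a /=; first by rewrite !weight1.
  rewrite weight_cons IH /w0; case: ifP => ab; rewrite !weight_cons //.
  rewrite addrA; congr (_ + _)%R.
  by case/orP: ab => /andP[/eqP-> /eqP->] //; rewrite (ws y z) (ws z x) addrC.
apply: (nm w0); split.
- by move=> a b; rewrite /w0 at_xyC (ws a b).
- move=> a b rab; rewrite /w0; case: ifP => ab.
    by apply: addr_gt0; apply: wp; rewrite /subdiv_rel !eqxx !orbT.
  by apply: wp; rewrite /subdiv_rel rab ab.
- move=> u v uA vA q qp ql qu qN; rewrite !W.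
  have zq : z \notin u :: q.
    apply: contra zA; elim: (q) (u) uA qp => [|b p IH] a aA /=.
      by rewrite inE => _ /eqP->.
    case/andP=> /(ps_supp ps)/andP[_ bA] pp; rewrite inE => /predU1P[->//|].
    exact: IH.
  have := wN u v; rewrite !inE uA vA !orbT => /(_ isT isT (insert_mid x y z u q)).
  rewrite /subdiv_paths (@add_vertex_old _ A) //; apply.
  + exact: insert_mid_path.
  + by rewrite insert_mid_last.
  + exact: insert_mid_uniq.
  (* [insert_mid] is injective on paths that avoid [z]: deleting [z] recovers them. *)
  + move=> E; apply: qN; move: zq; rewrite inE negb_or => /andP[_ zq].
    rewrite -(filter_insert_mid x y u zq) E filter_insert_mid //.
    by apply: contra zA => /(ps_sub ps uA vA).
Qed.

(* Each triple [((x, y), s)] prescribes the replacement of the virtual edge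
   [x y] by a path of [G] with interior [s]. *)
Lemma realize_edges (jobs : seq (G * G * seq G)) (A : {set G}) r N :
  path_system A r N -> nonmetric A r N ->
  uniq (flatten (map snd jobs)) ->
  {in flatten (map snd jobs), forall z, z \notin A} ->
  {in jobs, forall j, r j.1.1 j.1.2 /\ path (@adj G) j.1.1 (rcons j.2 j.1.2)} ->
  pairwise (fun j k => ~~ at_xy j.1.1 j.1.2 k.1.1 k.1.2) jobs ->
  (forall a b, r a b -> adj a b \/ exists2 j, j \in jobs & at_xy j.1.1 j.1.2 a b) ->
  exists (A' : {set G}) r' N', [/\ path_system A' r' N', nonmetric A' r' N',
    A \subset A' & forall a b, r' a b -> adj a b].
Proof.
elim: jobs A r N => [|[[x y] s] jobs IHj] A r N.
  move=> ps nm _ _ _ _ rG; exists A, r, N; split=> // a b /rG[//|].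
  by case.
(* The first interior vertex [z] subdivides [x y]: the half [x z] is an edge of [G], and the half
   [z y] is the virtual edge of the remaining job. *)
elim: s x A r N => [|z s IHs] x A r N ps nm U D J.
  rewrite /= => /andP[_ PW] rG.
  case: (J ((x, y), [::])); first exact: mem_head.
  rewrite /= andbT => rxy axy.
  apply: (IHj A r N) => //.
  - by move=> j jJ; apply: J; rewrite inE jJ orbT.
  - move=> a b /rG[|[j]]; first by left.
    rewrite inE => /predU1P[->|jJ ab]; last by right; exists j.
    by case/orP=> /andP[/eqP-> /eqP->]; left; rewrite // adj_sym.
rewrite [pairwise _ _]/= => /andP[PW1 PW] rG.
case: (J ((x, y), z :: s)); first exact: mem_head.
rewrite /= => rxy /andP[axz pz].
have zA : z \notin A by apply: D; rewrite mem_head.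
have xy : x != y.
  apply: contraTneq rxy => ->; apply/negP => ryy.
  have yA : y \in A by case/andP: (ps_supp ps ryy).
  by have := ps_edge ps yA yA ryy; rewrite (ps_refl ps).
have := IHs z (z |: A) (subdiv_rel x y z r) (subdiv_paths x y z N).
case.
- exact: subdiv_system.
- exact: nonmetric_subdiv.
- by case/andP: U.
- move=> t /= tI; rewrite !inE negb_or D; last by rewrite inE tI orbT.
  by rewrite andbT; apply: contraTneq tI => ->; case/andP: U.
- move=> j; rewrite inE => /predU1P[->|jJ] /=.
    by rewrite /subdiv_rel !eqxx orbT orbT.
  case: (J j); first by rewrite inE jJ orbT.
  move=> rj pj; split=> //; rewrite /subdiv_rel rj /=.
  by move/allP: PW1 => /(_ _ jJ) ->.
- rewrite /= PW andbT; apply/allP => j jJ /=.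
  have [rj _] : r j.1.1 j.1.2 /\ path (@adj G) j.1.1 (rcons j.2 j.1.2).
    by apply: J; rewrite inE jJ orbT.
  case/andP: (ps_supp ps rj) => j1 j2; apply/negP => /orP[]/andP[/eqP E1 /eqP E2].
    by rewrite -E1 j1 in zA.
  by rewrite -E2 j2 in zA.
- move=> a b /or3P[/andP[/rG[|[j]]]||].
  + by left.
  + rewrite inE => /predU1P[->|jJ ab _]; first by move=> /= ->.
    by right; exists j; rewrite // inE jJ orbT.
  + case/andP=> /eqP-> /orP[]/eqP->; first by left; rewrite adj_sym.
    by right; exists ((z, y), s); rewrite ?mem_head // /at_xy /= !eqxx.
  + case/andP=> /eqP-> /orP[]/eqP->; first by left.
    by right; exists ((z, y), s); rewrite ?mem_head // /at_xy /= !eqxx orbT.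
move=> A' [r' [N' [ps' nm' sub rG']]]; exists A', r', N'; split=> //.
by apply: subset_trans sub; apply: subsetUr.
Qed.

(** While [A] is not everything, connectedness gives an edge that leaves [A], and its outer end is
    hung on as a pendant vertex. The other edges of [G] stay outside the relation. *)
Lemma extend_to_all (A : {set G}) r N x0 :
  connected_off (set0 : {set G}) -> x0 \in A ->
  path_system A r N -> nonmetric A r N -> (forall a b, r a b -> adj a b) ->
  exists r' N', [/\ path_system [set: G] r' N', nonmetric [set: G] r' N'
    & forall a b, r' a b -> adj a b].
Proof.
move=> conn; have [n] := ubnP #|~: A|; elim: n A r N => // n IH A r N leA x0A ps nm rG.
have [/existsP[x /existsP[z /and3P[xA zA xz]]]|H] :=
    boolP [exists x, exists z, [&& x \in A, z \notin A & adj x z]].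
  apply: (IH (z |: A) (pendant_rel r x z) (add_vertex z N (fun v => x :: N x v))).
  - rewrite ltnS in leA; apply: leq_trans leA; apply: proper_card.
    rewrite properEneq setCS subsetUr andbT; apply: contraTneq zA => E.
    by rewrite -in_setC -E !inE eqxx.
  - by rewrite inE x0A orbT.
  - exact: pendant_system.
  - exact: nonmetric_pendant.
  - move=> a b /orP[/orP[/rG//|]|] /andP[/eqP-> /eqP->] //; by rewrite adj_sym.
have AT : A = [set: G].
  apply/setP => v; rewrite inE.
  have := conn x0 v; rewrite !inE => /(_ isT isT).
  move/(@closed_connect _ _ A) => <- //; move=> a b /= /and3P[ab _ _].
  have K c d : adj c d -> c \in A -> d \in A.
    move=> cd cA; apply: contraR H => dA; apply/existsP; exists c.
    by apply/existsP; exists d; rewrite cA dA cd.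
  by apply/idP/idP; apply: K => //; rewrite adj_sym.
by rewrite -AT; exists r, N.
Qed.

(** * From closure under subpaths to consistency *)

Section Consistent.
Variables (r : rel G) (N : G -> G -> seq G).
Hypothesis ps : path_system [set: G] r N.
Let P u v := u :: N u v.

Let in_all (u : G) : u \in [set: G]. Proof. by rewrite inE. Qed.
Local Hint Resolve in_all : core.

(** The second conjunct determines the remainder [t'] from any factorization at [y], in particular
    from one at the last vertex with some property. *)
Lemma ps_segment c d s x t y :
  P c d = s ++ x :: t -> y \in x :: t ->
  exists t', P c d = s ++ P x y ++ t' /\ (forall t1 t2, x :: t = t1 ++ y :: t2 -> t' = t2).
Proof.
move=> E; have Ex : N x d = t.
  case: s E => [|a s] [-> // E]; exact: (ps_suffix ps _ _ E).
have Ux : uniq (x :: t) by rewrite -Ex; apply: (ps_uniq ps).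
rewrite inE; case: eqP => [-> _|_ /= /mem_split[t1 [t2 Et]]].
  exists t; rewrite /P (ps_refl ps) //; split=> // t1 t2 E2.
  by have [] := @cat_uniq_mid _ x [::] t t1 t2.
exists t2; rewrite E /P (ps_prefix ps (in_all x) (in_all d) (etrans Ex Et)).
rewrite Et /= cat_rcons; split=> // t3 t4 E2.
by have [] := @cat_uniq_mid _ y (x :: t1) t2 t3 t4; rewrite //= -Et.
Qed.

Lemma ps_between c d x y : x \in P c d -> y \in P c d ->
  exists s t, P c d = s ++ P x y ++ t \/ P c d = s ++ P y x ++ t.
Proof.
move=> /mem_split[s [t E]]; rewrite {1}E mem_cat => /orP[/mem_split[s1 [s2 Es]]|].
  move: E; rewrite Es -catA /= => E.
  case: (ps_segment (y := x) E) => [|t' [-> _]].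
    by rewrite inE mem_cat mem_head !orbT.
  by exists s1, t'; right.
by case/(ps_segment E) => t' [Et _]; exists s, t'; left.
Qed.

(** Let [x] and [y] be the first and last vertices of [P a b] on [P c d]. Then [P x y] is a segment
    of [P a b], and it or its reverse is a segment of [P c d], so it is exactly the intersection. A
    common edge has both ends on [P x y], where they are consecutive because vertices do not
    repeat. *)
Lemma ps_consistent : (forall a b, r a b -> adj a b) -> consistent P.
Proof.
move=> rG.
have Prev u v : P v u = rev (P u v) by apply: (ps_rev ps).
have Puniq u v : uniq (P u v) by apply: (ps_uniq ps).
split=> // [u v|a b c d [z [zab zcd]]].
  rewrite /upath /= eqxx (ps_last ps) // eqxx /=; apply/andP; split; last exact: Puniq.
  by apply: sub_path (ps_path ps (in_all u) (in_all v)).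
case: (@split_first _ (mem (P c d)) (P a b)) => [|s1 [x [s2 [E1 xcd n1]]]].
  by apply/hasP; exists z.
case: (@split_last _ (mem (P c d)) (x :: s2)) => [|s3 [y [s4 [E2 ycd n4]]]].
  by apply/hasP; exists x; rewrite ?mem_head.
case: (ps_segment (y := y) E1) => [|t [E3 H]].
  by rewrite E2 mem_cat mem_head orbT.
have {H} Et : t = s4 by apply: H E2.
rewrite {t}Et in E3; clear E1 E2.
have sub t : t \in P x y -> t \in P c d.
  case: (ps_between xcd ycd) => s5 [s6 [->|->]] tx; rewrite !mem_cat ?tx ?orbT //.
  by rewrite Prev mem_rev tx orbT.
have onE t : (t \in P x y) = (t \in P a b) && (t \in P c d).
  apply/idP/andP => [tx|[]]; first by rewrite E3 !mem_cat tx orbT sub.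
  rewrite E3 !mem_cat => /orP[ts1 tc|/orP[//|ts4 tc]].
    by case/hasP: n1; exists t.
  by case/hasP: n4; exists t.
exists x, y; split=> // u v.
have cat_edge (s m s' : seq G) : edge_on m u v -> edge_on (s ++ m ++ s') u v.
  case/orP=> /mem_stepsP[p1 [p2 ->]]; apply/orP; [left|right]; apply/mem_stepsP;
  by exists (s ++ p1), (p2 ++ s'); rewrite -!catA.
apply/idP/andP => [H|[Hab Hcd]].
  split; first by rewrite E3; apply: cat_edge.
  case: (ps_between xcd ycd) => s5 [s6 [->|->]]; apply: cat_edge => //.
  by rewrite Prev edge_on_rev.
have mem_edge p : edge_on p u v -> (u \in p) && (v \in p).
  by case/orP=> /mem_stepsP[p1 [p2 ->]]; rewrite !mem_cat !inE !eqxx !orbT.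
have /andP[uab vab] := mem_edge _ Hab; have /andP[ucd vcd] := mem_edge _ Hcd.
have ux : u \in P x y by rewrite onE uab.
have vx : v \in P x y by rewrite onE vab.
have K p q : p \in P x y -> q \in P x y -> (p, q) \in steps (P a b) ->
    (p, q) \in steps (P x y).
  move=> px qx /mem_stepsP[p1 [p2 E]]; case/mem_split: (px) => m1 [m2 Em].
  have U := Puniq a b; move: (E3); rewrite E Em -!catA catA /= => E4.
  have [||_ E5] := @cat_uniq_mid _ p p1 (q :: p2) (s1 ++ m1) (m2 ++ s4) => //.
    by rewrite -E.
  apply/mem_stepsP; case: m2 Em E4 E5 => [|q' m2] Em E4 /= E5.
    case/negP: n4; apply/hasP; exists q; last exact: sub.
    by rewrite -E5 mem_head.
  by exists m1, m2; case: E5 => ->.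
by case/orP: Hab => /K K1; apply/orP; [left|right]; apply: K1.
Qed.

End Consistent.

(** Every edge of [r] is realized by a job, possibly with empty interior, so nothing is asked about
    adjacency in [G] between vertices of [A]. *)
Theorem not_strictly_metrizable (A : {set G}) r N x0 (jobs : seq (G * G * seq G)) :
  connected_off (set0 : {set G}) -> x0 \in A ->
  path_system A r N -> nonmetric A r N ->
  uniq (flatten (map snd jobs)) ->
  {in flatten (map snd jobs), forall z, z \notin A} ->
  {in jobs, forall j, r j.1.1 j.1.2 /\ path (@adj G) j.1.1 (rcons j.2 j.1.2)} ->
  pairwise (fun j k => ~~ at_xy j.1.1 j.1.2 k.1.1 k.1.2) jobs ->
  (forall a b, r a b -> exists2 j, j \in jobs & at_xy j.1.1 j.1.2 a b) ->
  ~ strictly_metrizable R G.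
Proof.
move=> conn x0A ps nm U D J PW rJ.
case: (realize_edges ps nm U D J PW) => [a b /rJ|A1 [r1 [N1 [ps1 nm1 sub1 r1G]]]].
  by right.
have x0A1 : x0 \in A1 by apply: (subsetP sub1).
case: (extend_to_all conn x0A1 ps1 nm1 r1G) => r2 [N2 [ps2 nm2 r2G]].
move=> /(_ _ (ps_consistent ps2 r2G)) [w [ws wp wN]].
apply: (nm2 w); split=> // [a b /r2G/wp //|u v _ _ q qp ql qu qN].
apply: wN; last by move=> [].
rewrite /upath /= eqxx ql eqxx /=; apply/andP; split=> //.
by apply: sub_path qp.
Qed.

End Metric.

(** * Specifications, embeddings and certificates *)

(* A small multigraph on the vertices [0 .. n - 1]. The third component of an
   edge distinguishes parallel edges; when it is positive, the edge may only be
   realized by a path of length at least two. *)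
Definition edge := (nat * nat * nat)%type.
Definition src (e : edge) := e.1.1.
Definition tgt (e : edge) := e.1.2.
Definition tag (e : edge) := e.2.
Definition spec := (nat * seq edge)%type.

Definition wf (H : spec) : bool :=
  uniq H.2 && all (fun e => [&& src e < H.1, tgt e < H.1 & src e != tgt e]) H.2.

Definition same_ends (e e' : edge) : bool :=
  (e.1 == e'.1) || (e.1 == (tgt e', src e')).

Definition simple_spec (H : spec) : bool :=
  pairwise (fun e e' => ~~ same_ends e e') H.2.

Definition joined (H : spec) : rel nat :=
  fun i j => has (fun e => (e.1 == (i, j)) || (e.1 == (j, i))) H.2.

Lemma joinedC H : symmetric (joined H).
Proof. by move=> i j; apply: eq_has => e; rewrite orbC. Qed.

Section Embedding.
Variable G : sgraph.

(** All vertices of the subdivision, listed with multiplicity: [uniq] of this list says at once that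
    [f] is injective on the branch vertices and that the interiors [g e] are simple, pairwise
    disjoint and free of branch vertices. *)
Definition image (H : spec) (f : nat -> G) (g : edge -> seq G) : seq G :=
  map f (iota 0 H.1) ++ flatten (map g H.2).

Definition emb (H : spec) (f : nat -> G) (g : edge -> seq G) : Prop :=
  uniq (image H f g) /\
  {in H.2, forall e, path (@adj G) (f (src e)) (rcons (g e) (f (tgt e))) /\
                     (0 < tag e -> g e <> [::])}.

Definition contains (H : spec) : Prop := exists f g, emb H f g.

Lemma emb_inj H f g i j : emb H f g -> i < H.1 -> j < H.1 -> f i = f j -> i = j.
Proof.
move=> [+ _] iH jH fij; rewrite cat_uniq => /andP[U _].
apply/eqP; rewrite -(nth_uniq (f 0) _ _ U) ?size_map ?size_iota //.
by rewrite !(nth_map 0) ?size_iota // !nth_iota // !add0n fij.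
Qed.

End Embedding.

Definition certificate := (seq (seq nat) * seq (seq nat))%type.

Section Certificate.
Variables (H : spec) (c : certificate).

(* The routes between adjacent vertices are the edges; the others are listed in
   [c.1], in one direction only. The paths in [c.2] compete with the routes
   between their ends. The vertex [i] itself is left out of the result. *)
Definition cert_tail (i j : nat) : seq nat :=
  if i == j then [::] else if joined H i j then [:: j] else
  behead (head [::] [seq p <- c.1 ++ map rev c.1 | (head 0 p == i) && (last 0 p == j)]).

Definition cert_pair (i j : nat) : bool :=
  let p := cert_tail i j in
  [&& path (joined H) i p, last i p == j, uniq (i :: p), all (ltn^~ H.1) p,
      i :: p == rev (j :: cert_tail j i),
      (if p is s :: t then cert_tail s j == t else true)
    & joined H i j ==> (p == [:: j])].

Definition ordered (s : nat * nat) := if s.1 <= s.2 then s else (s.2, s.1).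

Definition cert_swap (q : seq nat) : bool :=
  if q is i :: t then
    [&& path (joined H) i t, uniq q, all (ltn^~ H.1) q & t != cert_tail i (last i t)]
  else false.

Definition cert_route (q : seq nat) : seq nat :=
  head 0 q :: cert_tail (head 0 q) (last 0 q).

Definition cert_ok : bool :=
  [&& wf H, simple_spec H, 0 < H.1,
      all (fun i => all (cert_pair i) (iota 0 H.1)) (iota 0 H.1),
      c.2 != [::], all cert_swap c.2
    & perm_eq (flatten [seq map ordered (steps (cert_route q)) | q <- c.2])
              (flatten [seq map ordered (steps q) | q <- c.2])].

Section Transfer.
Variables (R : realType) (G : sgraph) (f : nat -> G) (g : edge -> seq G).
Hypotheses (ok : cert_ok) (fg : emb H f g).

(** The system of the certificate lives on the branch vertices alone, with virtual edges; the
    branches [g e] enter afterwards as jobs. *)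
Let A : {set G} := [set x in map f (iota 0 H.1)].
Let idx (x : G) := index x (map f (iota 0 H.1)).
Let r : rel G := fun a b => [&& a \in A, b \in A & joined H (idx a) (idx b)].
Let N (u v : G) := map f (cert_tail (idx u) (idx v)).

Let inA i : i < H.1 -> f i \in A.
Proof. by move=> iH; rewrite inE map_f // mem_iota. Qed.

Let AP u : u \in A -> exists2 i, i < H.1 & u = f i.
Proof. by rewrite inE => /mapP[i]; rewrite mem_iota => iH ->; exists i. Qed.

Let idxK i : i < H.1 -> idx (f i) = i.
Proof.
move=> iH; apply: (emb_inj fg _ iH).
  by have := inA iH; rewrite inE -index_mem size_map size_iota.
have fi : f i \in map f (iota 0 H.1) by have := inA iH; rewrite inE.
rewrite -[RHS](nth_index (f 0) fi) (nth_map 0) ?nth_iota ?add0n //.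
  by move: fi; rewrite -index_mem size_map size_iota.
by move: fi; rewrite -index_mem size_map.
Qed.

Let okP i j : i < H.1 -> j < H.1 -> cert_pair i j.
Proof.
move=> iH jH; case/and5P: ok => _ _ _ /allP/(_ i) + _.
by rewrite mem_iota => /(_ iH)/allP/(_ j); rewrite mem_iota => /(_ jH).
Qed.

Let rE i j : i < H.1 -> j < H.1 -> r (f i) (f j) = joined H i j.
Proof. by move=> iH jH; rewrite /r !inA // !idxK. Qed.

Let path_r i p : i < H.1 -> all (ltn^~ H.1) p ->
  path r (f i) (map f p) = path (joined H) i p.
Proof. by elim: p i => //= j p IH i iH /andP[jH pH]; rewrite rE // IH. Qed.

Let finj : {in [pred i | i < H.1] &, injective f}.
Proof. by move=> i j iH jH; apply: (emb_inj fg). Qed.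

Let map_inj p q : all (ltn^~ H.1) p -> all (ltn^~ H.1) q -> map f p = map f q -> p = q.
Proof.
elim: p q => [|i p IH] [|j q] //= /andP[iH pH] /andP[jH qH] [/finj -> //].
by move/IH => ->.
Qed.

Let uniq_f p : all (ltn^~ H.1) p -> uniq (map f p) = uniq p.
Proof.
move=> pH; apply: map_inj_in_uniq => i j /(allP pH) iH /(allP pH) jH.
exact: finj.
Qed.

Lemma cert_system : path_system A r N.
Proof.
split.
- by move=> u v /and3P[-> ->].
- by move=> u v; rewrite /r joinedC andbCA.
- move=> _ _ /AP[i iH ->] /AP[j jH ->]; case/and5P: (okP iH jH) => p1 _ _ p4 _.
  by rewrite /N !idxK // path_r.
- move=> _ _ /AP[i iH ->] /AP[j jH ->]; case/and5P: (okP iH jH) => _ /eqP p2 _ _ _.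
  by rewrite /N !idxK // last_map p2.
- move=> _ _ /AP[i iH ->] /AP[j jH ->]; case/and5P: (okP iH jH) => _ _ p3 p4 _.
  by rewrite /N !idxK // -map_cons uniq_f //= iH.
- move=> _ _ /AP[i iH ->] /AP[j jH ->]; case/and5P: (okP iH jH) => _ _ _ p4 _.
  by rewrite /N !idxK // => w /mapP[k /(allP p4) kH ->]; apply: inA.
- move=> _ _ /AP[i iH ->] /AP[j jH ->].
  case/and5P: (okP iH jH) => _ _ _ _ /andP[/eqP p5 _].
  by rewrite /N !idxK // -!map_cons -map_rev -p5.
- move=> _ _ /AP[i iH ->] /AP[j jH ->] s p.
  case/and5P: (okP iH jH) => _ _ _ + /and3P[_ + _]; rewrite /N !idxK //.
  case: (cert_tail i j) => //= k t /andP[kH _] /eqP kt [<- <-].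
  by rewrite idxK // kt.
- move=> _ _ /AP[i iH ->] /AP[j jH ->]; rewrite rE // => ij.
  case/and5P: (okP iH jH) => _ _ _ _ /and3P[_ _]; rewrite ij /N !idxK //.
  by move/eqP ->.
Qed.

Let weightE (w : G -> G -> R) p : (forall x y, w x y = w y x) ->
  weight w (map f p) = (\sum_(s <- map ordered (steps p)) w (f s.1) (f s.2))%R.
Proof.
move=> ws; rewrite /weight /steps.
have -> : zip (map f p) (behead (map f p)) = [seq (f s.1, f s.2) | s <- zip p (behead p)].
  by rewrite behead_map; elim: p (behead p) => [|i p IH] [|j q] //=; rewrite IH.
rewrite !big_map; apply: eq_bigr => s _; rewrite /ordered.
by case: ifP => //= _; rewrite ws.
Qed.

(** Each route would be strictly lighter than its competitor, but both families use the same edges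
    with the same multiplicities, so their total weights coincide for every symmetric [w]. *)
Lemma cert_nonmetric : nonmetric R A r N.
Proof.
move=> w [ws _ wN]; case/and5P: ok => _ _ _ _ /and3P[c0 /allP cs pm].
have sumE (h : seq nat -> seq nat) s :
    (\sum_(q <- s) weight w (map f (h q)) =
     \sum_(t <- flatten [seq map ordered (steps (h q)) | q <- s]) w (f t.1) (f t.2))%R.
  rewrite big_flatten big_map; apply: eq_bigr => q _; exact: weightE.
have lt q : q \in c.2 -> (weight w (map f (cert_route q)) < weight w (map f q))%R.
  move/cs; case: q => //= i t /and4P[pt ut /andP[iH tH] tn].
  have lH : last i t < H.1.
    by apply: (allP (a := ltn^~ H.1) (s := i :: t)); rewrite ?mem_last //= iH.
  have := wN (f i) (f (last i t)) (inA iH) (inA lH) (map f t).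
  rewrite /N !idxK //; apply.
  - by rewrite path_r.
  - by rewrite last_map.
  - by rewrite -map_cons uniq_f //= iH.
  - move/map_inj => E; case/eqP: tn; apply: E => //.
    by case/and5P: (okP iH lH).
have E : (\sum_(q <- c.2) weight w (map f (cert_route q)) =
          \sum_(q <- c.2) weight w (map f q))%R.
  by rewrite (sumE cert_route) (sumE id); apply: perm_big.
suff : (\sum_(q <- c.2) weight w (map f (cert_route q)) <
        \sum_(q <- c.2) weight w (map f q))%R by rewrite E ltxx.
case: (c.2) c0 lt => // q s _ lt; rewrite !big_cons ltr_leD ?lt ?mem_head //.
rewrite big_seq [leRHS]big_seq; apply: ler_sum => p ps.
by rewrite ltW // lt // inE ps orbT.
Qed.

Theorem cert_not_metrizable :
  connected_off (set0 : {set G}) -> ~ strictly_metrizable R G.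
Proof.
move=> conn; case/and5P: ok => /andP[_ /allP wfH] sim n0 _ _.
case: fg => U pe; move: U; rewrite /image cat_uniq => /and3P[_ D U].
apply: (@not_strictly_metrizable R G A r N (f 0)
  [seq ((f (src e), f (tgt e)), g e) | e <- H.2]) => //.
- exact: inA.
- exact: cert_system.
- exact: cert_nonmetric.
- by rewrite -map_comp.
- rewrite -map_comp => z zI; apply: contra D; rewrite inE => zA.
  by apply/hasP; exists z.
- move=> _ /mapP[e eH ->] /=; split; last by case: (pe e eH).
  case/and3P: (wfH e eH) => sH tH _; rewrite rE //.
  by apply/hasP; exists e => //; rewrite -surjective_pairing eqxx.
- rewrite pairwise_map.
  apply: (sub_in_pairwise (P := mem H.2) _ _ sim); last by apply/allP.
  move=> e e' eH eH' /=.
  case/and3P: (wfH e eH) => sH tH _; case/and3P: (wfH e' eH') => sH' tH' _.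
  apply: contra; rewrite /at_xy /same_ends => /orP[]/andP[/eqP E1 /eqP E2].
    apply/orP; left; apply/eqP; rewrite (surjective_pairing e.1) (surjective_pairing e'.1).
    by congr pair; apply/esym/finj.
  apply/orP; right; apply/eqP; rewrite (surjective_pairing e.1).
  by congr pair; apply/esym/finj.
- move=> a b /and3P[/AP[i iH ->] /AP[j jH ->]]; rewrite !idxK // => /hasP[e eH ij].
  exists ((f (src e), f (tgt e)), g e); first exact: map_f.
  by case/orP: ij => /eqP E; rewrite /at_xy /src /tgt /= E /= !eqxx ?orbT.
Qed.

End Transfer.
End Certificate.

(** * Elementary extensions of an embedding *)

(** The halves get tag [0]: a branch split at an interior vertex may have halves of length one, even
    if its own length was bounded below by two. *)
Definition split_edge (H : spec) (e : edge) : spec :=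
  (H.1.+1, [:: (src e, H.1, 0), (H.1, tgt e, 0) & rem e H.2]).

Definition add_path (H : spec) (i j : nat) : spec := (H.1, (i, j, 0) :: H.2).

(* The tags only have to differ from those in use. *)
Definition double_edge (H : spec) (e : edge) : spec :=
  (H.1, [:: (src e, tgt e, 3), (src e, tgt e, 4) & rem e H.2]).

(** Each length bound is cashed in for an actual subdividing vertex, after which all tags are
    [0]. *)
Definition normalize (H : spec) : spec :=
  foldl split_edge H [seq e <- H.2 | 0 < tag e].

(* A point of a subdivided multigraph: a branch vertex, or an unspecified
   interior point of an edge. *)
Definition point := (nat + edge)%type.

Definition points (H : spec) : seq point := map inl (iota 0 H.1) ++ map inr H.2.

Definition attach (H : spec) (p : point) : spec * nat :=
  match p with inl i => (H, i) | inr e => (split_edge H e, H.1) end.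

Definition ear_ext (H : spec) (p q : point) : spec :=
  let H1 := attach H p in let H2 := attach H1.1 q in add_path H2.1 H1.2 H2.2.

Definition on_edge (p : point) (e : edge) : bool :=
  match p with inl i => (i == src e) || (i == tgt e) | inr e' => e' == e end.

Definition apart (H : spec) (p q : point) : bool :=
  (p != q) && ~~ has (fun e => on_edge p e && on_edge q e) H.2.

Definition ear_pairs (H : spec) : seq (point * point) :=
  [seq pq <- [seq (p, q) | p <- points H, q <- points H] |
    apart H pq.1 pq.2 && (index pq.1 (points H) < index pq.2 (points H))].

(** The doubled segment is the whole branch, a final part, an initial part or a middle part of it.
    In the last case [H.1] is its end nearer to [tgt e], and [H.1.+1] the one nearer to [src e]. *)
Definition bigon_exts (H : spec) (e : edge) : seq spec :=
  let H1 := split_edge H e in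
  [:: double_edge H e; double_edge H1 (H.1, tgt e, 0); double_edge H1 (src e, H.1, 0);
      double_edge (split_edge H1 (src e, H.1, 0)) (H.1.+1, H.1, 0)].

Lemma wf_edge H e : wf H -> e \in H.2 -> [/\ src e < H.1, tgt e < H.1 & src e != tgt e].
Proof. by case/andP=> _ /allP wH /wH /and3P. Qed.

Lemma wf_fresh H i j t : wf H -> (H.1 <= i) || (H.1 <= j) -> (i, j, t) \notin H.2.
Proof.
move=> wH ij; apply/negP => /(wf_edge wH)[/= iH jH _].
by move: ij; rewrite leqNgt [H.1 <= j]leqNgt iH jH.
Qed.

Lemma wf_split H e : wf H -> e \in H.2 -> wf (split_edge H e).
Proof.
move=> wH eH; have [sH tH st] := wf_edge wH eH.
have [U _] := andP wH; have remP e' : e' \in rem e H.2 -> e' \in H.2 by apply: mem_rem.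
rewrite /wf /= !inE rem_uniq // andbT /src /tgt /= -/(src e) -/(tgt e).
rewrite !ltnS !leqnn (ltnW sH) (ltnW tH) !xpair_eqE !negb_or.
rewrite [H.1 == tgt e]eq_sym !(ltn_eqF sH, ltn_eqF tH) /=.
have N i j : (H.1 <= i) || (H.1 <= j) -> (i, j, 0) \notin rem e H.2.
  by move=> ij; apply: contra (wf_fresh 0 wH ij) => /remP.
rewrite !N ?leqnn ?orbT //=; apply/allP => e' /remP /(wf_edge wH)[s' t' st'].
by rewrite /= !ltnS (ltnW s') (ltnW t') st'.
Qed.

Section Operations.
Variable G : sgraph.

Lemma perm_flatten_map (T1 : eqType) (B : T1 -> seq G) s t :
  perm_eq s t -> perm_eq (flatten (map B s)) (flatten (map B t)).
Proof.
move=> st; apply/permP => a; rewrite !count_flatten.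
exact/perm_sumn/perm_map/perm_map.
Qed.

Section OneEdge.
Variables (H : spec) (f : nat -> G) (g : edge -> seq G) (e : edge).
Hypotheses (wH : wf H) (fg : emb H f g) (eH : e \in H.2).

Lemma image_rem : perm_eq (image H f g)
  (map f (iota 0 H.1) ++ g e ++ flatten (map g (rem e H.2))).
Proof. by rewrite perm_cat2l; apply: (perm_flatten_map g (perm_to_rem eH)). Qed.

Definition split_f (z : G) i := if i == H.1 then z else f i.
Definition split_g (l1 l2 : seq G) (e' : edge) :=
  if e' == (src e, H.1, 0) then l1 else if e' == (H.1, tgt e, 0) then l2 else g e'.

Lemma split_f_old z i : i < H.1 -> split_f z i = f i.
Proof. by rewrite /split_f => /ltn_eqF ->. Qed.

Lemma split_g_old l1 l2 e' : e' \in H.2 -> split_g l1 l2 e' = g e'.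
Proof.
move=> eH'; rewrite /split_g; case: eqP => [E|_].
  by have := @wf_fresh H (src e) H.1 0 wH; rewrite leqnn orbT -E eH' => /(_ isT).
case: eqP => [E|//].
by have := @wf_fresh H H.1 (tgt e) 0 wH; rewrite leqnn -E eH' => /(_ isT).
Qed.

Lemma split_g1 l1 l2 : split_g l1 l2 (src e, H.1, 0) = l1.
Proof. by rewrite /split_g eqxx. Qed.

Lemma split_g2 l1 l2 : split_g l1 l2 (H.1, tgt e, 0) = l2.
Proof.
have [sH _ _] := wf_edge wH eH.
by rewrite /split_g eqxx !xpair_eqE eq_sym (ltn_eqF sH).
Qed.

Lemma split_image z l1 l2 : g e = l1 ++ z :: l2 ->
  perm_eq (image (split_edge H e) (split_f z) (split_g l1 l2)) (image H f g).
Proof.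
move=> ge; rewrite (permPr image_rem) ge.
have -> : image (split_edge H e) (split_f z) (split_g l1 l2) =
    (map f (iota 0 H.1) ++ [:: z]) ++ l1 ++ l2 ++ flatten (map g (rem e H.2)).
  rewrite /image; congr (_ ++ _).
    rewrite -[(split_edge H e).1]/(H.1.+1) -addn1 iotaD map_cat /= add0n.
    rewrite {2}/split_f eqxx; congr (_ ++ _); apply/eq_in_map => i.
    by rewrite mem_iota; apply: split_f_old.
  rewrite /= split_g1 split_g2; congr (_ ++ (_ ++ flatten _)).
  by apply/eq_in_map => e' /mem_rem eH'; apply: split_g_old.
apply/permP => a; rewrite -(cat1s z l2) !count_cat.
by rewrite -!addnA !add0n; congr (_ + _); rewrite addnCA.
Qed.

Lemma split_emb z l1 l2 : g e = l1 ++ z :: l2 ->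
  emb (split_edge H e) (split_f z) (split_g l1 l2).
Proof.
move=> ge; have [sH tH _] := wf_edge wH eH; case: fg => U pe.
split; first by rewrite (perm_uniq (split_image ge)).
have [pe' _] := pe e eH; move: pe'.
rewrite ge rcons_cat cat_path /= => /and3P[p1 p2 p3].
move=> e'; rewrite !inE => /or3P[/eqP->|/eqP->|/mem_rem eH'].
- rewrite split_g1 /src /tgt /= split_f_old // /split_f eqxx; split=> //.
  by rewrite rcons_path p1.
- have := split_f_old z tH; rewrite split_g2 /src /tgt /= => ->.
  by rewrite /split_f eqxx.
- have [s' t' _] := wf_edge wH eH'.
  by rewrite split_g_old // !split_f_old //; apply: pe.
Qed.

Definition double_g (d1 d2 : seq G) (e' : edge) :=
  if e' == (src e, tgt e, 3) then d1 else if e' == (src e, tgt e, 4) then d2 else g e'.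

(** The two new paths may run through vertices of the branch [g e] that they replace; crossing
    chords of a branch produce such paths. *)
Lemma double_emb d1 d2 :
  wf (double_edge H e) -> d1 <> [::] -> d2 <> [::] -> uniq (d1 ++ d2) ->
  path (@adj G) (f (src e)) (rcons d1 (f (tgt e))) ->
  path (@adj G) (f (src e)) (rcons d2 (f (tgt e))) ->
  {in d1 ++ d2, forall z, z \in image H f g -> z \in g e} ->
  emb (double_edge H e) f (double_g d1 d2).
Proof.
move=> wD n1 n2 U12 p1 p2 fresh; case: fg => U pe.
have E1 : double_g d1 d2 (src e, tgt e, 3) = d1 by rewrite /double_g eqxx.
have E2 : double_g d1 d2 (src e, tgt e, 4) = d2.
  by rewrite /double_g eqxx xpair_eqE /= andbF.
have Eo e' : e' \in rem e H.2 -> double_g d1 d2 e' = g e'.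
  move=> eH'; have [+ _] := andP wD; rewrite /double_edge /= inE negb_or.
  case/and3P=> /andP[_ N1] N2 _; rewrite /double_g.
  case: eqP => [E|_]; first by rewrite E (negPf N1) in eH'.
  by case: eqP => [E|//]; rewrite E (negPf N2) in eH'.
split; last first.
  move=> e'; rewrite !inE => /or3P[/eqP->|/eqP->|eH'].
  - by rewrite E1.
  - by rewrite E2.
  - by rewrite Eo //; apply: pe; apply: mem_rem eH'.
rewrite /image /= E1 E2.
have -> : map (double_g d1 d2) (rem e H.2) = map g (rem e H.2).
  by apply/eq_in_map => e' eH'; apply: Eo.
move: U; rewrite (perm_uniq image_rem) => U0.
have pm : perm_eq (map f (iota 0 H.1) ++ d1 ++ d2 ++ flatten (map g (rem e H.2)))
  ((d1 ++ d2) ++ (map f (iota 0 H.1) ++ flatten (map g (rem e H.2)))).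
  by rewrite -[in X in perm_eq _ X]catA perm_catCA perm_cat2l perm_catCA.
rewrite (perm_uniq pm) cat_uniq U12 /=.
move: U0; rewrite uniq_catCA cat_uniq => /and3P[_ D ->]; rewrite andbT.
apply/hasPn => z zI; apply/negP => /fresh; rewrite (perm_mem image_rem).
have zI2 : z \in map f (iota 0 H.1) ++ g e ++ flatten (map g (rem e H.2)).
  by move: zI; rewrite !mem_cat => /orP[->|->]; rewrite ?orbT.
by move/(_ zI2) => zg; case/hasP: D; exists z.
Qed.

End OneEdge.

Lemma add_path_emb H f g i j d :
  emb H f g -> wf (add_path H i j) -> uniq d ->
  {in d, forall z, z \notin image H f g} ->
  path (@adj G) (f i) (rcons d (f j)) ->
  contains G (add_path H i j).
Proof.
move=> [U pe] /andP[/= /andP[ij _] _] Ud D pd.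
exists f, (fun e => if e == (i, j, 0) then d else g e).
have Eo e : e \in H.2 -> (if e == (i, j, 0) then d else g e) = g e.
  by case: eqP => // ->; rewrite (negPf ij).
split.
  rewrite /image /= eqxx.
  have -> : [seq if e == (i, j, 0) then d else g e | e <- H.2] = map g H.2.
    by apply/eq_in_map => e; apply: Eo.
  rewrite uniq_catCA cat_uniq Ud -/(image H f g) U andbT /=.
  by apply/hasPn => z zI; apply/negP => /D; rewrite zI.
move=> e; rewrite inE => /predU1P[->|eH]; first by rewrite eqxx.
by rewrite Eo //; apply: pe.
Qed.

Lemma normalize_contains H : wf H -> contains G H -> contains G (normalize H).
Proof.
rewrite /normalize => wH.
have : uniq [seq e <- H.2 | 0 < tag e] by rewrite filter_uniq //; case/andP: wH.
have : {subset [seq e <- H.2 | 0 < tag e] <= H.2}.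
  by move=> e; rewrite mem_filter => /andP[].
have : all (fun e => 0 < tag e) [seq e <- H.2 | 0 < tag e] by apply: filter_all.
move: [seq e <- H.2 | 0 < tag e] => s.
elim: s H wH => //= e s IH H wH /andP[te ts] sub /andP[es us].
case=> f [g fg]; have eH : e \in H.2 by apply: sub; rewrite mem_head.
apply: IH => //; first exact: wf_split.
  move=> e' es'; rewrite !inE; apply/orP; right; apply/orP; right.
  rewrite mem_rem_uniq; last by case/andP: wH.
  rewrite !inE sub ?inE ?es' ?orbT // andbT.
  by apply: contraNneq es => <-.
case: (proj2 fg e eH) => _ /(_ te).
case E: (g e) => [//|z l] _.
by exists (split_f H f z), (split_g H g e [::] l); apply: split_emb.
Qed.

Definition located (H : spec) (f : nat -> G) (g : edge -> seq G) (p : point) (a : G) : Prop :=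
  match p with inl i => i < H.1 /\ f i = a | inr e => e \in H.2 /\ a \in g e end.

Lemma attach_emb H f g p a : wf H -> emb H f g -> located H f g p a ->
  let H1 := attach H p in
  exists f1 g1, [/\ emb H1.1 f1 g1, wf H1.1, H1.2 < H1.1.1 /\ f1 H1.2 = a,
     image H1.1 f1 g1 =i image H f g &
     forall q b, q != p -> located H f g q b -> located H1.1 f1 g1 q b].
Proof.
move=> wH fg; case: p => [i|e] /= [iH fi]; first by exists f, g; split.
case/mem_split: fi => l1 [l2 ge].
exists (split_f H f a), (split_g H g e l1 l2); split.
- exact: split_emb.
- exact: wf_split.
- by rewrite /split_f eqxx.
- exact/perm_mem/split_image.
- move=> [j|e'] b qp /=.
    by case=> jH <-; rewrite split_f_old // ltnW.
  case=> eH' be; rewrite split_g_old //; split=> //.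
  rewrite !inE; apply/orP; right; apply/orP; right.
  rewrite mem_rem_uniq; last by case/andP: wH.
  by rewrite !inE eH' andbT.
Qed.

Lemma ear_ext_emb H f g p q a b d :
  wf H -> emb H f g -> located H f g p a -> located H f g q b -> p != q ->
  wf (ear_ext H p q) -> uniq d -> {in d, forall z, z \notin image H f g} ->
  path (@adj G) a (rcons d b) -> a != b ->
  contains G (ear_ext H p q).
Proof.
move=> wH fg pa qb pq wE Ud D pd ab.
have [f1 [g1 [fg1 w1 [i1 fa] im1 loc1]]] := attach_emb wH fg pa.
have qb1 := loc1 q b (contra_neq (@esym _ _ _) pq) qb.
have [f2 [g2 [fg2 w2 [i2 fb] im2 loc2]]] := attach_emb w1 fg1 qb1.
have [] := loc2 (inl (attach H p).2) a.
- apply: contra_neq ab => E; move: qb1; rewrite -E /= => -[_].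
  by rewrite fa.
- by [].
move=> i1' fa2; apply: (add_path_emb fg2) (Ud) _ _ => //.
  by move=> z /D; rewrite -im1 -im2.
by rewrite fa2 fb.
Qed.

Lemma bigon_ext_emb H f g e c1 a c2 b c3 d1 d2 :
  wf H -> emb H f g -> e \in H.2 -> all wf (bigon_exts H e) ->
  f (src e) :: rcons (g e) (f (tgt e)) = c1 ++ a :: c2 ++ b :: c3 ->
  d1 <> [::] -> d2 <> [::] -> uniq (d1 ++ d2) ->
  path (@adj G) a (rcons d1 b) -> path (@adj G) a (rcons d2 b) ->
  {in d1 ++ d2, forall z, z \in image H f g -> z \in c2} ->
  exists2 H', H' \in bigon_exts H e & contains G H'.
Proof.
move=> wH fg eH /and5P[w1 w2 w3 w4 _] C n1 n2 U p1 p2 D.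
have wS := wf_split wH eH.
case: c1 C => [|x c1] [Ea]; case/lastP: c3 => [|c3 y].
- rewrite cats1 => /rcons_inj[ge Eb].
  exists (double_edge H e); first by rewrite !inE eqxx.
  exists f, (double_g g e d1 d2); apply: double_emb; rewrite // ?Ea ?Eb //.
  by rewrite ge.
- rewrite -rcons_cons -rcons_cat => /rcons_inj[ge _].
  exists (double_edge (split_edge H e) (src e, H.1, 0)); first by rewrite !inE eqxx !orbT.
  exists (split_f H f b), (double_g (split_g H g e c2 c3) (src e, H.1, 0) d1 d2).
  have [sH _ _] := wf_edge wH eH.
  apply: double_emb; rewrite // ?inE ?eqxx //; try exact: split_emb.
  + by rewrite /src /tgt /= split_f_old // /split_f eqxx Ea.
  + by rewrite /src /tgt /= split_f_old // /split_f eqxx Ea.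
  + by move=> z zd; rewrite (perm_mem (split_image f wH eH ge)) split_g1; apply: D.
- rewrite cats1 -rcons_cons -rcons_cat => /rcons_inj[ge Eb].
  exists (double_edge (split_edge H e) (H.1, tgt e, 0)); first by rewrite !inE eqxx !orbT.
  exists (split_f H f a), (double_g (split_g H g e c1 c2) (H.1, tgt e, 0) d1 d2).
  have [_ tH _] := wf_edge wH eH.
  apply: double_emb; rewrite // ?inE ?eqxx ?orbT //; try exact: split_emb.
  + have := split_f_old f a tH; rewrite /src /tgt /= => ->.
    by rewrite /split_f eqxx -[e.1.2]/(tgt e) Eb.
  + have := split_f_old f a tH; rewrite /src /tgt /= => ->.
    by rewrite /split_f eqxx -[e.1.2]/(tgt e) Eb.
  + by move=> z zd; rewrite (perm_mem (split_image f wH eH ge)) split_g2 //; apply: D.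
- rewrite -rcons_cons -rcons_cat -rcons_cons -rcons_cat => /rcons_inj[ge _].
  have ge' : g e = (c1 ++ a :: c2) ++ b :: c3 by rewrite ge -catA.
  exists (double_edge (split_edge (split_edge H e) (src e, H.1, 0)) (H.1.+1, H.1, 0)).
    by rewrite !inE eqxx !orbT.
  set H1 := split_edge H e; set e1 := (src e, H.1, 0).
  set f1 := split_f H f b; set g1 := split_g H g e (c1 ++ a :: c2) c3.
  have fg1 : emb H1 f1 g1 by apply: split_emb.
  have eH1 : e1 \in H1.2 by rewrite mem_head.
  have ge1 : g1 e1 = c1 ++ a :: c2 by rewrite /g1 split_g1.
  have tE : tgt e1 = H.1 by [].
  exists (split_f H1 f1 a), (double_g (split_g H1 g1 e1 c1 c2) (H.1.+1, H.1, 0) d1 d2).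
  have fE1 : split_f H1 f1 a H.1.+1 = a by rewrite /split_f eqxx.
  have fE2 : split_f H1 f1 a H.1 = b by rewrite split_f_old //= /f1 /split_f eqxx.
  apply: (double_emb (split_emb wS fg1 eH1 ge1)) => //.
  + by rewrite !inE eqxx orbT.
  + by rewrite /src /tgt /= fE1 fE2.
  + by rewrite /src /tgt /= fE1 fE2.
  + move=> z zd; rewrite (perm_mem (split_image f1 wS eH1 ge1)).
    rewrite (perm_mem (split_image f wH eH ge')) => /(D z zd).
    by have -> := split_g2 g1 wS eH1 c1 c2.
Qed.

End Operations.

(** * Topological minors of small graphs *)

Lemma adj_path_rev (G : sgraph) (a b : G) d :
  path (@adj G) a (rcons d b) = path (@adj G) b (rcons (rev d) a).
Proof.
rewrite -[LHS]/(sorted _ (a :: rcons d b)) -[RHS]/(sorted _ (b :: rcons (rev d) a)).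
have -> : b :: rcons (rev d) a = rev (a :: rcons d b) by rewrite rev_cons rev_rcons.
by rewrite rev_sorted; apply: eq_sorted => x y; rewrite adj_sym.
Qed.

Definition edge_at (H : spec) (u v : nat) : edge :=
  head (0, 0, 0) [seq e <- H.2 | (e.1 == (u, v)) || (e.1 == (v, u))].

Lemma edge_atP H u v : joined H u v ->
  edge_at H u v \in H.2 /\
  ((edge_at H u v).1 = (u, v) \/ (edge_at H u v).1 = (v, u)).
Proof.
rewrite /joined /edge_at has_filter.
case E: [seq e <- H.2 | _] => [//|e s] _ /=.
have : e \in [seq e <- H.2 | (e.1 == (u, v)) || (e.1 == (v, u))] by rewrite E mem_head.
by rewrite mem_filter => /andP[/orP[]/eqP-> ->]; split=> //; [left|right].
Qed.

Fixpoint walk_points (H : spec) (u : nat) (p : seq nat) : seq point :=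
  if p is v :: p' then
    inr (edge_at H u v) :: (if p' is [::] then [::] else inl v :: walk_points H v p')
  else [::].

(* A topological embedding of [F] in [H]: [phi] lists the images of the vertices
   and [ws] the walks that realize the edges. *)
Definition minor_ok (F H : spec) (phi : seq nat) (ws : seq (seq nat)) : bool :=
  let pts := map inl phi ++ flatten [seq walk_points H (head 0 p) (behead p) | p <- ws] in
  [&& size phi == F.1, size ws == size F.2, uniq F.2, uniq pts, all (mem (points H)) pts
    & all (fun ep => [&& 1 < size ep.2, head 0 ep.2 == nth 0 phi (src ep.1),
                         last 0 ep.2 == nth 0 phi (tgt ep.1), sorted (joined H) ep.2
                       & (0 < tag ep.1) ==> (2 < size ep.2)]) (zip F.2 ws)].

Section Composition.
Variables (G : sgraph) (H : spec) (f : nat -> G) (g : edge -> seq G).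
Hypothesis fg : emb H f g.

Definition block (p : point) : seq G :=
  match p with inl i => [:: f i] | inr e => g e end.

Lemma image_blocks : image H f g = flatten (map block (points H)).
Proof.
rewrite /image /points map_cat flatten_cat -!map_comp; congr (_ ++ _).
by elim: (iota _ _) => //= i s ->.
Qed.

Lemma uniq_blocks s t : uniq (flatten (map block s)) -> uniq t -> {subset t <= s} ->
  uniq (flatten (map block t)).
Proof.
move=> Us Ut st; suff [s' pm] : exists s', perm_eq s (t ++ s').
  move: Us; rewrite (perm_uniq (perm_flatten_map _ pm)) map_cat flatten_cat cat_uniq.
  by case/andP.
elim: t s Ut st {Us} => [|x t IH] s /=; first by exists s.
move=> /andP[xt Ut] st; case: (IH (rem x s) Ut) => [y yt|s' pm].
  have : y \in s by apply: st; rewrite inE yt orbT.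
  rewrite (perm_mem (perm_to_rem (st x (mem_head _ _)))) inE => /predU1P[E|//].
  by rewrite -E yt in xt.
exists s'; apply: perm_trans (perm_to_rem (st x (mem_head _ _))) _.
by rewrite /= perm_cons.
Qed.

Definition oriented (u v : nat) : seq G :=
  if (edge_at H u v).1 == (u, v) then g (edge_at H u v) else rev (g (edge_at H u v)).

Fixpoint expand (u : nat) (p : seq nat) : seq G :=
  if p is v :: p' then
    oriented u v ++ (if p' is [::] then [::] else f v :: expand v p')
  else [::].

Lemma oriented_path u v : joined H u v ->
  path (@adj G) (f u) (rcons (oriented u v) (f v)).
Proof.
case/edge_atP=> eH ends; have [+ _] := proj2 fg _ eH.
rewrite /oriented /src /tgt; case: eqP => [-> //|ne].
by case: ends => [//|->] /=; rewrite adj_path_rev.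
Qed.

Lemma expand_perm u p : perm_eq (expand u p) (flatten (map block (walk_points H u p))).
Proof.
elim: p u => //= v p IH u; apply: perm_cat.
  by rewrite /oriented; case: ifP => // _; rewrite perm_rev.
by case: p IH => // w p IH; rewrite [map _ _]/= [flatten _]/= perm_cons; apply: IH.
Qed.

Lemma expand_path u p : p != [::] -> path (joined H) u p ->
  path (@adj G) (f u) (rcons (expand u p) (f (last u p))).
Proof.
elim: p u => //= v p IH u _ /andP[uv pv].
have := oriented_path uv; rewrite rcons_cat cat_path rcons_path.
case: p IH pv => [_ _|w p IH pv] /=; first by rewrite andbT.
by case/andP=> -> ->; apply: IH.
Qed.

(** Topological embeddings compose: walks in [H] expand to paths of [G], and these stay disjoint
    because distinct points of [H] have disjoint blocks. *)
Lemma minor_contains F phi ws : minor_ok F H phi ws -> contains G F.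
Proof.
case/and5P=> /eqP sphi /eqP sws UF Upts /andP[/allP sub /allP ok].
pose w e := nth [::] ws (index e F.2).
have wE : map w F.2 = ws.
  apply: (@eq_from_nth _ [::]) => [|k]; rewrite size_map ?sws // => kF.
  by rewrite (nth_map (0, 0, 0)) // /w index_uniq.
have okE e : e \in F.2 -> (e, w e) \in zip F.2 ws.
  move=> eF; have kF : index e F.2 < size F.2 by rewrite index_mem.
  rewrite -{1}(nth_index (0, 0, 0) eF) -nth_zip //.
  by apply: mem_nth; rewrite size_zip sws minnn.
exists (fun i => f (nth 0 phi i)), (fun e => expand (head 0 (w e)) (behead (w e))).
split; last first.
  move=> e /okE/ok /=; case: (w e) => [//|u p] /and5P[/= sp /eqP <- /eqP <- pp tp].
  split; first by apply: expand_path => //; case: (p) sp.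
  by move=> te; move: tp; rewrite te; case: (p) => [|a [|b q]] //= _; case: (oriented _ _).
set pts := map inl phi ++ _ in Upts sub.
have U := uniq_blocks (t := pts) _ Upts sub.
have {}U : uniq (flatten (map block pts)).
  by apply: U; rewrite -image_blocks; case: fg.
suff pm : perm_eq (image F (fun i => f (nth 0 phi i))
    (fun e => expand (head 0 (w e)) (behead (w e)))) (flatten (map block pts)).
  by rewrite (perm_uniq pm).
rewrite /image /pts map_cat flatten_cat; apply: perm_cat.
  have -> : map (fun i => f (nth 0 phi i)) (iota 0 F.1) = map f phi.
    by rewrite -sphi (map_comp f (nth 0 phi)) map_nth_iota0 // take_size.
  by elim: (phi) => //= i s; rewrite perm_cons.
rewrite -wE -map_comp; elim: (F.2) => //= e s IH.
by rewrite map_cat flatten_cat; apply: perm_cat => //; apply: expand_perm.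
Qed.

End Composition.

Fixpoint first_some (A B : Type) (f : A -> option B) (s : seq A) : option B :=
  if s is x :: s' then if f x is Some y then Some y else first_some f s' else None.

Definition lookup (m : seq (nat * nat)) x := ohead [seq xy.2 | xy <- m & xy.1 == x].

(* Backtracking search; only its result is checked, by [minor_ok]. The edges of
   [F] must be listed so that the source of each is an endpoint of an earlier
   one. *)
Section Search.
Variables (nb : seq (seq nat)) (dg : seq nat).

Fixpoint route (B : Type) (fuel : nat) (goal : option nat) (d : nat)
    (used p : seq nat) (u : nat) (k : seq nat -> seq nat -> option B) : option B :=
  if fuel is fuel'.+1 then
    first_some (fun v =>
      let r := if goal is Some w then if v == w then k used (rcons p v) else None
               else if (v \in used) || (size (nth [::] nb v) < d) then None
               else k (v :: used) (rcons p v) in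
      if r is Some _ then r else
      if v \in used then None
      else route fuel' goal d (v :: used) (rcons p v) v k) (nth [::] nb u)
  else None.

Fixpoint place (es : seq edge) (m : seq (nat * nat)) (used : seq nat)
    (ws : seq (seq nat)) : option (seq (nat * nat) * seq (seq nat)) :=
  if es is e :: es' then
    if lookup m (src e) is Some u then
      route 4 (lookup m (tgt e)) (nth 0 dg (tgt e)) used [:: u] u (fun used' p =>
        if (size p == 2) && has (fun q => (q == p) || (q == rev p)) ws then None
        else place es' ((tgt e, last 0 p) :: m) used' (rcons ws p))
    else None
  else Some (m, ws).

End Search.

Definition nbrs (H : spec) u := [seq v <- iota 0 H.1 | joined H u v].

Definition find_minor (F H : spec) :=
  let nb := map (nbrs H) (iota 0 H.1) in
  let dg := map (fun x => size (nbrs F x)) (iota 0 F.1) in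
  let s := src (head (0, 0, 0) F.2) in
  first_some (fun v => if size (nth [::] nb v) < nth 0 dg s then None
                       else place nb dg F.2 [:: (s, v)] [:: v] [::]) (iota 0 H.1).

Definition has_minor (F H : spec) : bool :=
  if find_minor F H is Some (m, ws) then
    minor_ok F H [seq odflt 0 (lookup m i) | i <- iota 0 F.1] ws
  else false.

Lemma has_minor_contains (G : sgraph) F H : has_minor F H -> contains G H -> contains G F.
Proof.
rewrite /has_minor; case: (find_minor F H) => // -[m ws] ok [f [g fg]].
exact: (minor_contains fg ok).
Qed.

(* [find] instead of [has], whose disjunctions are evaluated eagerly by
   [vm_compute]. *)
Definition has_one_of (Fs : seq spec) (H : spec) : bool :=
  wf H && (find (has_minor^~ (normalize H)) Fs < size Fs).

Lemma has_one_of_contains (G : sgraph) Fs H : has_one_of Fs H -> contains G H ->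
  exists2 F, F \in Fs & contains G F.
Proof.
rewrite /has_one_of -has_find => /andP[wH /hasP[F FFs FH]] /(normalize_contains wH) cH.
by exists F => //; apply: has_minor_contains FH cH.
Qed.

Definition ears_ok Fs H := all (fun pq => has_one_of Fs (ear_ext H pq.1 pq.2)) (ear_pairs H).
Definition bigons_ok Fs H := all (fun e => all (has_one_of Fs) (bigon_exts H e)) H.2.

(** * The target graphs, the forbidden graphs and the finite checks *)

Definition graph_spec n (es : seq (nat * nat)) : spec := (n, [seq (e, 0) | e <- es]).
(* The digits are the lower bounds on the lengths of the three branches. *)
Definition theta122 : spec := (2, [:: (0, 1, 0); (0, 1, 1); (1, 0, 1)]).
Definition theta222 : spec := (2, [:: (0, 1, 1); (0, 1, 2); (1, 0, 1)]).
Definition K23 := graph_spec 5 [:: (0,2);(2,1);(0,3);(3,1);(1,4);(4,0)].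
Definition K4 := graph_spec 4 [:: (0,1);(0,2);(0,3);(1,2);(1,3);(2,3)].
Definition W4 := graph_spec 5 [:: (4,0);(4,1);(4,2);(4,3);(0,1);(1,2);(2,3);(3,0)].
Definition W4' := graph_spec 5 [:: (4,0);(4,1);(4,2);(4,3);(0,1);(1,2);(2,3);(3,0);(0,2)].
Definition W5 := graph_spec 6
  [:: (5,0);(5,1);(5,2);(5,3);(5,4);(0,1);(1,2);(2,3);(3,4);(4,0)].
Definition K5 := graph_spec 5
  [:: (0,1);(0,2);(0,3);(0,4);(1,2);(1,3);(1,4);(2,3);(2,4);(3,4)].

(* [K24] and [linked_bigons*] consist of two 4-cycles and two disjoint paths
   joining opposite vertices of the first to opposite vertices of the second;
   the paths have total length 0, 1 and 2. *)
Definition K24 := graph_spec 6 [:: (0,2);(2,1);(1,3);(3,0);(0,4);(4,1);(0,5);(5,1)].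
Definition prism := graph_spec 6 [:: (0,1);(1,2);(0,2);(0,3);(1,4);(3,4);(2,5);(4,5);(3,5)].
Definition K33 := graph_spec 6 [:: (0,3);(3,1);(1,4);(4,0);(0,5);(5,1);(3,2);(4,2);(5,2)].
Definition linked_bigons1 := graph_spec 7
  [:: (1,3);(3,0);(1,4);(4,0);(1,5);(5,2);(1,6);(6,2);(0,2)].
Definition linked_bigons2 := graph_spec 8
  [:: (0,4);(4,1);(0,5);(5,1);(0,2);(1,3);(2,6);(6,3);(2,7);(7,3)].
(* [K4] with the edges of a triangle, respectively at a vertex, subdivided. *)
Definition K4_triangle := graph_spec 7
  [:: (3,0);(3,1);(3,2);(0,4);(4,1);(1,5);(5,2);(2,6);(6,0)].
Definition K4_claw := graph_spec 7
  [:: (0,4);(4,1);(0,5);(5,2);(0,6);(6,3);(1,2);(2,3);(1,3)].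

Definition bad := [:: K24; prism; K33; linked_bigons1; linked_bigons2; K4_triangle; K4_claw].
(** For [K24] and the linked bigons, the four competitors join the two free vertices of one 4-cycle
    to those of the other. Every route goes one way round and its competitor the other way, so both
    families use each edge of the cycles once and each linking edge twice. *)
Definition cert_K24 : certificate :=
  ([:: [:: 0; 2; 1]; [:: 2; 0; 3]; [:: 2; 0; 4]; [:: 2; 1; 5]; [:: 3; 1; 4];
       [:: 3; 0; 5]; [:: 4; 0; 5]],
   [:: [:: 2; 1; 4]; [:: 2; 0; 5]; [:: 3; 0; 4]; [:: 3; 1; 5]]).
Definition cert_prism : certificate :=
  ([:: [:: 0; 1; 4]; [:: 0; 3; 5]; [:: 1; 4; 3]; [:: 1; 2; 5]; [:: 2; 0; 3];
       [:: 2; 5; 4]],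
   [:: [:: 0; 3; 4]; [:: 0; 2; 5]; [:: 1; 0; 3]; [:: 1; 4; 5]; [:: 2; 5; 3];
        [:: 2; 1; 4]]).
Definition cert_K33 : certificate :=
  ([:: [:: 0; 3; 1]; [:: 0; 3; 2]; [:: 1; 4; 2]; [:: 3; 0; 4]; [:: 3; 1; 5];
       [:: 4; 0; 5]],
   [:: [:: 0; 4; 2]; [:: 1; 3; 2]; [:: 3; 0; 5]; [:: 4; 1; 5]]).
Definition cert_linked_bigons1 : certificate :=
  ([:: [:: 0; 3; 1]; [:: 0; 2; 5]; [:: 0; 2; 6]; [:: 1; 5; 2]; [:: 2; 0; 3];
       [:: 2; 0; 4]; [:: 3; 0; 4]; [:: 3; 0; 2; 5]; [:: 3; 1; 6]; [:: 4; 1; 5];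
       [:: 4; 0; 2; 6]; [:: 5; 1; 6]],
   [:: [:: 3; 1; 5]; [:: 3; 0; 2; 6]; [:: 4; 0; 2; 5]; [:: 4; 1; 6]]).
Definition cert_linked_bigons2 : certificate :=
  ([:: [:: 0; 4; 1]; [:: 0; 2; 6; 3]; [:: 0; 2; 6]; [:: 0; 2; 7]; [:: 1; 3; 6; 2];
       [:: 1; 3; 6]; [:: 1; 3; 7]; [:: 2; 6; 3]; [:: 2; 0; 4]; [:: 2; 0; 5];
       [:: 3; 1; 4]; [:: 3; 1; 5]; [:: 4; 0; 5]; [:: 4; 0; 2; 6]; [:: 4; 1; 3; 7];
       [:: 5; 1; 3; 6]; [:: 5; 0; 2; 7]; [:: 6; 2; 7]],
   [:: [:: 4; 1; 3; 6]; [:: 4; 0; 2; 7]; [:: 5; 0; 2; 6]; [:: 5; 1; 3; 7]]).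
Definition cert_K4_triangle : certificate :=
  ([:: [:: 0; 4; 1]; [:: 0; 6; 2]; [:: 0; 4; 1; 5]; [:: 1; 5; 2]; [:: 1; 5; 2; 6];
       [:: 2; 6; 0; 4]; [:: 3; 1; 4]; [:: 3; 2; 5]; [:: 3; 0; 6]; [:: 4; 1; 5];
       [:: 4; 0; 6]; [:: 5; 2; 6]],
   [:: [:: 0; 6; 2; 5]; [:: 1; 4; 0; 6]; [:: 2; 5; 1; 4]; [:: 3; 0; 4]; [:: 3; 1; 5];
        [:: 3; 2; 6]]).
Definition cert_K4_claw : certificate :=
  ([:: [:: 0; 4; 1]; [:: 0; 5; 2]; [:: 0; 6; 3]; [:: 1; 2; 5]; [:: 1; 4; 0; 6];
       [:: 2; 5; 0; 4]; [:: 2; 3; 6]; [:: 3; 1; 4]; [:: 3; 6; 0; 5]; [:: 4; 0; 5];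
       [:: 4; 0; 6]; [:: 5; 0; 6]],
   [:: [:: 1; 4; 0; 5]; [:: 1; 3; 6]; [:: 2; 1; 4]; [:: 2; 5; 0; 6]; [:: 3; 6; 0; 4];
        [:: 3; 2; 5]]).

Definition certs :=
  [:: cert_K24; cert_prism; cert_K33; cert_linked_bigons1;
      cert_linked_bigons2; cert_K4_triangle; cert_K4_claw].

Lemma bad_certified : all (fun Hc => cert_ok Hc.1 Hc.2) (zip bad certs).
Proof. by vm_compute. Qed.

Lemma bad_not_metrizable (R : realType) (G : sgraph) F :
  connected_off (set0 : {set G}) -> F \in bad -> contains G F -> ~ strictly_metrizable R G.
Proof.
move=> conn FB [f [g fg]]; have [c ok] : exists c, cert_ok F c.
  exists (nth ([::], [::]) certs (index F bad)).
  apply: (allP bad_certified (F, _)); rewrite -{1}(nth_index (0, [::]) FB) -nth_zip //.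
  by apply: mem_nth; have -> : size (zip bad certs) = size bad by []; rewrite index_mem.
exact: (cert_not_metrizable ok fg conn).
Qed.

(** In the graphs that are grown, except [theta122], the ends of an edge are joined by two further
    disjoint paths of length at least two. Together with the doubled segment they form two 4-cycles
    up to subdivision, linked by what remains of the branch on zero, one or two sides. *)
Definition bad_bigons := [:: K24; linked_bigons1; linked_bigons2].

(** Only pairs of branch vertices are checked: this serves embeddings whose branches are single
    edges and so have no interior points. *)
Definition chords_ok Fs H :=
  all (fun pq => if pq is (inl _, inl _) then has_one_of Fs (ear_ext H pq.1 pq.2)
                 else true) (ear_pairs H).
Definition splits_ok Fs H := all (fun e => has_one_of Fs (split_edge H e)) H.2.

Lemma theta122_ears : ears_ok [:: K4] theta122. Proof. by vm_compute. Qed.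
Lemma theta122_bigons : bigons_ok [:: K23] theta122. Proof. by vm_compute. Qed.
Lemma theta222_ears : ears_ok [:: K4] theta222. Proof. by vm_compute. Qed.
Lemma theta222_bigons : bigons_ok bad_bigons theta222. Proof. by vm_compute. Qed.
Lemma theta222_in_K23 : has_minor theta222 K23. Proof. by vm_compute. Qed.
Lemma K4_ears : ears_ok [:: W4; prism; K33] K4. Proof. by vm_compute. Qed.
Lemma K4_bigons : bigons_ok bad_bigons K4. Proof. by vm_compute. Qed.
Lemma W4_ears : ears_ok [:: W4', W5 & bad] W4. Proof. by vm_compute. Qed.
Lemma W4_bigons : bigons_ok bad_bigons W4. Proof. by vm_compute. Qed.
Lemma W4'_ears : ears_ok [:: K5, W5 & bad] W4'. Proof. by vm_compute. Qed.
Lemma W4'_bigons : bigons_ok bad_bigons W4'. Proof. by vm_compute. Qed.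
Lemma W5_splits : splits_ok bad W5. Proof. by vm_compute. Qed.
Lemma W5_chords : chords_ok bad W5. Proof. by vm_compute. Qed.
Lemma K5_splits : splits_ok bad K5. Proof. by vm_compute. Qed.
Lemma K5_chords : chords_ok bad K5. Proof. by vm_compute. Qed.

(** * Ears *)

Section Lists.
Variables (T : eqType) (r : rel T).

Lemma path_mid a s1 b s2 : path r a (s1 ++ b :: s2) = path r a (rcons s1 b) && path r b s2.
Proof. by rewrite cat_path rcons_path /= andbA. Qed.

Lemma sorted_mid s1 a s2 : sorted r (s1 ++ a :: s2) = sorted r (rcons s1 a) && path r a s2.
Proof. by case: s1 => //= x s1; rewrite path_mid. Qed.

Lemma two_in_order (s : seq T) x y : x \in s -> y \in s -> x != y ->
  exists s1 s2 s3, s = s1 ++ x :: s2 ++ y :: s3 \/ s = s1 ++ y :: s2 ++ x :: s3.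
Proof.
move=> /mem_split[s1 [s2 ->]] + xy; rewrite mem_cat inE eq_sym (negPf xy) /=.
case/orP=> /mem_split[t1 [t2 ->]].
  by exists t1, t2, s2; right; rewrite -catA.
by exists s1, t1, t2; left.
Qed.

Lemma mid_interior (c1 : seq T) a c2 b c3 x m y :
  c1 ++ a :: c2 ++ b :: c3 = x :: rcons m y -> {subset c2 <= m}.
Proof.
have sub (s t : seq T) : {subset c2 <= s ++ c2 ++ t}.
  by move=> z zc; rewrite !mem_cat zc orbT.
case: c1 => [|x' c1] [_]; case/lastP: c3 => [|c3 y'].
- by rewrite cats1 => /rcons_inj[<- _].
- by rewrite -rcons_cons -rcons_cat => /rcons_inj[<- _]; apply: (sub [::]).
- rewrite cats1 -rcons_cons -rcons_cat => /rcons_inj[<- _].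
  by have := sub (rcons c1 a) [::]; rewrite cats0 cat_rcons.
- rewrite -rcons_cons -rcons_cat -rcons_cons -rcons_cat => /rcons_inj[<- _].
  by have := sub (rcons c1 a) (b :: c3); rewrite cat_rcons.
Qed.

Lemma mid_replace (c1 : seq T) a b c3 x m y d :
  c1 ++ [:: a, b & c3] = x :: rcons m y ->
  exists2 m', c1 ++ a :: d ++ b :: c3 = x :: rcons m' y & perm_eq m' (m ++ d).
Proof.
case: c1 => [|x' c1] [->]; case/lastP: c3 => [|c3 y'].
- rewrite -[[:: b]]/(rcons [::] b) => /rcons_inj[<- ->].
  by exists d; rewrite // cats1.
- rewrite -rcons_cons => /rcons_inj[<- ->]; exists (d ++ b :: c3).
    by rewrite rcons_cat.
  by rewrite perm_catC.
- rewrite -[[:: a; b]]/(rcons [:: a] b) -rcons_cat => /rcons_inj[<- ->].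
  exists (c1 ++ a :: d); last by rewrite -catA.
  by rewrite /= cats1 -rcons_cons -rcons_cat.
- rewrite -!rcons_cons -rcons_cat => /rcons_inj[<- ->].
  exists (c1 ++ a :: d ++ b :: c3); first by rewrite -rcons_cat -rcons_cons -rcons_cat.
  by rewrite -catA perm_cat2l /= perm_cons perm_catC.
Qed.

End Lists.

Section Ears.
Variable G : sgraph.
Hypothesis conn2 : k_connected 2 G.
Hypothesis no_compliant : forall x y : G, ~ compliant x y.

(** Deleting [z] leaves [y] connected to [s]; the ear stops at the first vertex of [S] on such a
    path, which differs from [z]. *)
Lemma ear_from (S : seq G) z s y :
  s \in S -> s != z -> z \in S -> y \notin S -> adj z y ->
  exists d b, [/\ b \in S, b != z, d <> [::], uniq d & {in d, forall t, t \notin S}] /\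
    path (@adj G) z (rcons d b).
Proof.
move=> sS sz zS yS zy.
have yz : y != z by apply: contraNneq yS => ->.
have [_ /(_ [set z])] := conn2; rewrite cards1 => /(_ isT y s); rewrite !inE.
case/(_ yz sz)/connectP=> p0 /shortenP[p pp Up _] sp.
have pz : all (fun t => t != z) (y :: p).
  elim: (p) (y) yz pp => [|b q IH] a az /=; first by rewrite az.
  by case/andP=> /and3P[_ _]; rewrite inE => bz pb; rewrite az; apply: IH.
have pa : path (@adj G) y p by apply: sub_path pp => a b /and3P[].
case: (@split_first _ (mem S) (y :: p)) => [|d [b [s2 [E bS nd]]]].
  by apply/hasP; exists s; rewrite // sp mem_last.
exists d, b; split.
  split=> //.
  - by apply: (allP pz); rewrite E mem_cat mem_head orbT.
  - by move=> d0; move: E; rewrite d0 => -[yb _]; move: yS; rewrite yb [b \in S]bS.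
  - by move: Up; rewrite E cat_uniq => /andP[].
  - by move=> t td; apply: contra nd => tS; apply/hasP; exists t.
case: d E nd => [[yb _]|y' d [yy E] nd]; first by move: yS; rewrite yb [b \in S]bS.
by move: pa; rewrite E path_mid /= -yy zy => /andP[].
Qed.

Definition closed_path (f : nat -> G) (g : edge -> seq G) (e : edge) : seq G :=
  f (src e) :: rcons (g e) (f (tgt e)).

Definition used_edge (H : spec) f g (a b : G) : bool :=
  has (fun e => edge_on (closed_path f g e) a b) H.2.

Definition exact_emb (H : spec) f g : Prop :=
  (forall z : G, z \in image H f g) /\ (forall a b : G, adj a b -> used_edge H f g a b).

Definition nonlocal_ear (H : spec) f g : Prop := exists a d b,
  [/\ a \in image H f g, b \in image H f g, a != b &
      {in H.2, forall e, a \in closed_path f g e -> b \in closed_path f g e -> False}] /\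
  [/\ uniq d, {in d, forall z : G, z \notin image H f g} & path (@adj G) a (rcons d b)].

Definition bigon (H : spec) f g : Prop := exists e c1 a c2 b c3 d1 d2,
  e \in H.2 /\
  [/\ closed_path f g e = c1 ++ a :: c2 ++ b :: c3, d1 <> [::], d2 <> [::] & uniq (d1 ++ d2)] /\
  [/\ path (@adj G) a (rcons d1 b), path (@adj G) a (rcons d2 b) &
      {in d1 ++ d2, forall z : G, z \in image H f g -> z \in c2}].

Definition improvable (H : spec) f g : Prop :=
  [\/ nonlocal_ear H f g, bigon H f g |
      exists f' g', emb H f' g' /\ size (image (G := G) H f g) < size (image (G := G) H f' g')].

Section Fixed.
Variables (H : spec) (f : nat -> G) (g : edge -> seq G).
Hypotheses (wH : wf H) (H2 : 1 < H.1) (fg : emb H f g).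
Local Notation im := (image H f g).
Local Notation cp := (closed_path f g).

Lemma f_image i : i < H.1 -> f i \in im.
Proof. by move=> iH; rewrite mem_cat map_f // mem_iota. Qed.

Lemma g_image e z : e \in H.2 -> z \in g e -> z \in im.
Proof.
by move=> eH zg; rewrite mem_cat; apply/orP; right; apply/flattenP; exists (g e); rewrite ?map_f.
Qed.

Lemma cp_image e z : e \in H.2 -> z \in cp e -> z \in im.
Proof.
move=> eH; have [sH tH _] := wf_edge wH eH.
rewrite inE mem_rcons inE => /or3P[/eqP->|/eqP->|]; rewrite ?f_image //.
exact: g_image.
Qed.

Lemma cp_uniq e : e \in H.2 -> uniq (cp e).
Proof.
move=> eH; have [sH tH st] := wf_edge wH eH; case: (fg) => U _.
move: U; rewrite (perm_uniq (image_rem f g eH)) cat_uniq => /and3P[_ D].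
rewrite cat_uniq => /andP[Ug _].
have fN i : i < H.1 -> f i \notin g e.
  move=> iH; apply: contra D => fi; apply/hasP; exists (f i).
    by rewrite mem_cat fi.
  by rewrite [_ \in _]map_f // mem_iota.
rewrite /= mem_rcons inE negb_or rcons_uniq !fN // Ug !andbT.
by apply: contra st => /eqP/(emb_inj fg sH tH) ->.
Qed.

Lemma cp_sorted e : e \in H.2 -> sorted (@adj G) (cp e).
Proof. by move=> eH; case: (proj2 fg e eH). Qed.

Lemma interior_unique e e' z : e \in H.2 -> e' \in H.2 -> z \in g e -> z \in cp e' -> e' = e.
Proof.
move=> eH eH' zg; have [sH' tH' _] := wf_edge wH eH'; case: (fg) => U _.
move: U; rewrite (perm_uniq (image_rem f g eH)) cat_uniq => /and3P[_ D].
rewrite cat_uniq => /and3P[_ D2 _].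
have fN i : i < H.1 -> z != f i.
  move=> iH; apply: contraNneq D => zf; apply/hasP; exists z.
    by rewrite mem_cat zg.
  by rewrite zf [_ \in _]map_f // mem_iota.
rewrite inE mem_rcons inE (negPf (fN _ sH')) (negPf (fN _ tH')) /= => zg'.
apply/eqP; apply: contraR D2 => ee; apply/hasP; exists z => //.
apply/flattenP; exists (g e'); rewrite ?map_f // mem_rem_uniq ?inE ?ee //.
by case/andP: wH.
Qed.

Lemma edge_on_mem (p : seq G) a b : edge_on p a b -> (a \in p) && (b \in p).
Proof. by case/orP=> /mem_stepsP[p1 [p2 ->]]; rewrite !mem_cat !inE !eqxx !orbT. Qed.

Lemma consecutive_used e s1 a b s2 : e \in H.2 -> cp e = s1 ++ [:: a, b & s2] ->
  used_edge H f g a b && used_edge H f g b a.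
Proof.
move=> eH E; apply/andP; split; apply/hasP; exists e => //; apply/orP.
  by left; apply/mem_stepsP; exists s1, s2.
by right; apply/mem_stepsP; exists s1, s2.
Qed.

Lemma unused_at_interior e z : e \in H.2 -> z \in g e -> degree z != 2 ->
  exists2 y, adj z y & ~~ used_edge H f g z y.
Proof.
move=> eH zg dz.
have [/existsP[y /andP[zy nu]]|nex] := boolP [exists y, adj z y && ~~ used_edge H f g z y].
  by exists y.
case/negP: dz; apply/eqP.
case/mem_split: (zg) => l1 [l2 gE].
have cE : cp e = (f (src e) :: l1) ++ z :: rcons l2 (f (tgt e)).
  by rewrite /closed_path gE rcons_cat.
have U := cp_uniq eH; have P := cp_sorted eH; rewrite cE in U P.
(* The two neighbours of [z] on the branch; the defaults are the ends of the branch, for [l1] or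
   [l2] empty. *)
set p := last (f (src e)) l1; set q := head (f (tgt e)) (rcons l2 (f (tgt e))).
have [q' Eq] : exists q', rcons l2 (f (tgt e)) = q :: q'.
  by rewrite /q; case: (l2) => [|x l]; [exists [::]|exists (rcons l (f (tgt e)))].
have Ep : f (src e) :: l1 = rcons (belast (f (src e)) l1) p by rewrite -lastI.
have pq : p != q.
  apply: contraTneq U => pq; rewrite Ep Eq pq cat_uniq negb_and; apply/orP; right.
  rewrite negb_and; apply/orP; left; rewrite negbK; apply/hasP; exists q.
    by rewrite !inE eqxx orbT.
  by rewrite [_ \in _]mem_rcons mem_head.
have zp : adj z p.
  by move: P; rewrite Ep cat_rcons sorted_mid /= => /andP[_ /andP[]]; rewrite adj_sym.
have zq : adj z q by move: P; rewrite sorted_mid Eq /= => /and3P[].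
rewrite /degree (_ : [set y | adj z y] = [set p; q]) ?cards2 ?pq //.
apply/setP => y; rewrite !inE; apply/idP/orP => [zy|[]/eqP->//].
move: nex; rewrite negb_exists => /forallP/(_ y); rewrite zy negbK.
case/hasP=> e' eH' eo; have /andP[ze _] := edge_on_mem eo.
rewrite (interior_unique eH eH' zg ze) cE in eo.
case/orP: eo => /mem_stepsP[p1 [p2 E]].
  have [_ E2] := cat_uniq_mid U E; right.
  by move: E2; rewrite Eq => -[->].
rewrite -cat_rcons in E; have [E1 _] := cat_uniq_mid U E; left.
by move: E1; rewrite Ep => /rcons_inj[_ ->].
Qed.

Lemma ear_at z y : z \in im -> adj z y -> ~~ used_edge H f g z y ->
  exists d b, [/\ b \in im, b != z, uniq d & {in d, forall t, t \notin im}] /\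
    [/\ path (@adj G) z (rcons d b) & d = [::] -> ~~ used_edge H f g z b].
Proof.
move=> zI zy nu; have [yI|yI] := boolP (y \in im).
  exists [::], y; split; last by split=> //=; rewrite zy.
  by split=> //; apply: contraTneq zy => ->; rewrite adj_irr.
have [s sI sz] : exists2 s, s \in im & s != z.
  have n01 : f 0 != f 1.
    by apply: contraTneq H2 => /(emb_inj fg (ltnW H2) H2).
  have [f0z|] := eqVneq (f 0) z; last by exists (f 0); rewrite ?f_image // ltnW.
  by exists (f 1); rewrite ?f_image // -f0z eq_sym.
have [d [b [[bI bz d0 Ud D] pd]]] := ear_from sI sz zI yI zy.
by exists d, b.
Qed.

(** The ear takes the place of the edge [a b] of the branch, so no vertex is lost and those of [d]
    are gained. *)
Lemma widen e c1 a b c3 d : e \in H.2 -> cp e = c1 ++ [:: a, b & c3] ->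
  d <> [::] -> uniq d -> {in d, forall t, t \notin im} -> path (@adj G) a (rcons d b) ->
  exists f' g', emb H f' g' /\ size im < size (image (G := G) H f' g').
Proof.
move=> eH E d0 Ud D pd; have P := cp_sorted eH.
have [m' Em pm] := mid_replace d (esym E).
pose g' e' := if e' == e then m' else g e'.
have g'E : map g' (rem e H.2) = map g (rem e H.2).
  apply/eq_in_map => e'; rewrite mem_rem_uniq ?inE; last by case/andP: wH.
  by rewrite /g' => /andP[/negPf ->].
have imE : perm_eq (image H f g') (im ++ d).
  rewrite (permPl (image_rem f g' eH)) g'E {1}/g' eqxx.
  rewrite (permPr (perm_cat (image_rem f g eH) (perm_refl d))) -!catA perm_cat2l.
  apply: (@perm_trans _ ((g e ++ d) ++ flatten (map g (rem e H.2)))).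
    by rewrite perm_cat2r.
  by rewrite -catA perm_cat2l perm_catC.
exists f, g'; split; last first.
  rewrite (perm_size imE) (size_cat im d); case: (d) d0 => //= x s _.
  by rewrite addnS ltnS leq_addr.
split.
  rewrite (perm_uniq imE) cat_uniq Ud andbT (proj1 fg) /=.
  by apply/hasPn => t /D.
move=> e' eH'; rewrite /g'; case: eqP => [->|_]; last exact: (proj2 fg).
split; last first.
  move=> _ m0; move/perm_size: pm; rewrite m0 size_cat.
  by case: (d) d0 => //= x s _; rewrite addnS.
rewrite -[path _ _ _]/(sorted (@adj G) (f (src e) :: rcons m' (f (tgt e)))) -Em.
move: P; rewrite E !sorted_mid path_mid /= => /and3P[-> _ ->].
by rewrite pd.
Qed.

(** If [c2] is nonempty, then [c2] and [d] are the two parallel paths of a bigon; otherwise the ear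
    lengthens the branch. *)
Lemma local_long e c1 a c2 b c3 d : e \in H.2 -> cp e = c1 ++ a :: c2 ++ b :: c3 ->
  d <> [::] -> uniq d -> {in d, forall t, t \notin im} -> path (@adj G) a (rcons d b) ->
  improvable H f g.
Proof.
move=> eH E d0 Ud D pd; have U := cp_uniq eH; have P := cp_sorted eH.
have [c0|c0] := eqVneq c2 [::]; last first.
  apply: Or32; exists e, c1, a, c2, b, c3, c2, d; split=> //; split; split=> //.
  - exact/eqP.
  - rewrite cat_uniq Ud andbT; apply/andP; split.
      move: U; rewrite E cat_uniq => /and3P[_ _] /= /andP[_].
      by rewrite cat_uniq => /andP[].
    apply/hasPn => t td; apply: contra (D t td) => tc; apply: (cp_image eH).
    by rewrite E mem_cat inE mem_cat [t \in c2]tc !orbT.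
  - by move: P; rewrite E sorted_mid path_mid => /and3P[].
  - by move=> z; rewrite mem_cat => /orP[//|/D/negP].
by rewrite c0 in E; apply: Or33; apply: widen eH E d0 Ud D pd.
Qed.

Lemma local_ear e z b d : e \in H.2 -> z \in cp e -> b \in cp e -> b != z ->
  d <> [::] -> uniq d -> {in d, forall t, t \notin im} -> path (@adj G) z (rcons d b) ->
  improvable H f g.
Proof.
move=> eH ze be bz d0 Ud D pd.
have [s1 [s2 [s3 [E|E]]]] := two_in_order be ze bz; last exact: local_long E d0 Ud D pd.
apply: (local_long eH E (d := rev d)).
- by move=> d1; apply: d0; rewrite -(revK d) d1.
- by rewrite rev_uniq.
- by move=> t; rewrite mem_rev; apply: D.
- by rewrite -adj_path_rev.
Qed.

(* A chord of shortest span: some interior vertex of its span has a further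
   edge, which leaves the path, is a chord of shorter span, or crosses the
   first one. *)
Lemma chord n e c1 a c2 b c3 : size c2 <= n -> e \in H.2 ->
  cp e = c1 ++ a :: c2 ++ b :: c3 -> adj a b -> c2 <> [::] -> improvable H f g.
Proof.
elim: n c1 a c2 b c3 => [|n IH] c1 a c2 b c3 sc eH E ab c0; first by case: (c2) sc c0.
have U := cp_uniq eH; have P := cp_sorted eH.
have Uc : uniq (a :: c2 ++ b :: c3) by move: U; rewrite E cat_uniq => /and3P[].
have pab : path (@adj G) a (rcons c2 b).
  by move: P; rewrite E sorted_mid path_mid => /and3P[].
have Uab : uniq (a :: rcons c2 b).
  by move: Uc; rewrite -cat_rcons -cat_cons cat_uniq => /andP[].
(* Otherwise [c2] would be the interior of a flat path parallel to [a b], making this edge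
   compliant. *)
have [z zc dz] : exists2 z, z \in c2 & degree z != 2.
  apply/hasP; rewrite -[has _ _]negbK -all_predC; apply/negP => /allP flat.
  apply: (@no_compliant a b); split=> //; exists (a :: rcons c2 b); last first.
    by case: (c2) c0 => // x [].
  split; first by move: Uab; rewrite /upath /= eqxx last_rcons eqxx pab.
  move=> z; rewrite inE mem_rcons inE => /or3P[/eqP->|/eqP->|/flat]; rewrite ?eqxx //=.
  by rewrite negbK => /eqP.
have zg : z \in g e by apply: (mid_interior (esym E)).
have zcp : z \in cp e by rewrite inE mem_rcons inE zg !orbT.
have [y zy nu] := unused_at_interior eH zg dz.
have [d [b' [[bI bz Ud D] [pd nu']]]] := ear_at (g_image eH zg) zy nu.
have [nonloc|] := boolP (b' \notin cp e).
  apply: Or31; exists z, d, b'; split=> //; split=> //.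
  - exact: g_image zg.
  - by rewrite eq_sym.
  - by move=> e' eH' ze'; rewrite (interior_unique eH eH' zg ze') (negPf nonloc).
rewrite negbK => be.
have [d0|d0] := eqVneq d [::]; last by apply: local_ear eH zcp be bz _ Ud D pd; apply/eqP.
rewrite d0 /= andbT in pd; move/(_ d0): nu' => nu'.
have za : z != a by apply: contraTneq Uc => <-; rewrite /= mem_cat zc.
have zb : z != b.
  by apply: contraTneq Uab => <-; rewrite /= rcons_uniq zc andbF.
have cpE : cp e = c1 ++ (a :: rcons c2 b) ++ c3 by rewrite E /= cat_rcons.
have [inside|outside] := boolP (b' \in a :: rcons c2 b).
  have zin : z \in a :: rcons c2 b by rewrite inE mem_rcons inE zc !orbT.
  (* Only the pair [(a, b)] spans all of [c2]. *)
  have shorter s1 x s2 y' s3 : a :: rcons c2 b = s1 ++ x :: s2 ++ y' :: s3 ->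
      ~ (x = a /\ y' = b) -> size s2 <= n.
    move=> Es nab; rewrite -ltnS; apply: leq_trans sc.
    have := congr1 size Es; rewrite /= size_rcons size_cat /= size_cat /= !addnS => -[sE].
    rewrite sE ltn_neqAle; apply/andP; split; last first.
      by rewrite addnCA leq_addr.
    apply/eqP => s13; apply: nab.
    have [s10 s30] : s1 = [::] /\ s3 = [::].
      move: s13; rewrite addnCA -[LHS]addn0 => /addnI/esym/eqP.
      by rewrite addn_eq0 !size_eq0 => /andP[/eqP-> /eqP->].
    by move: Es; rewrite s10 s30 /= cats1 => -[-> /rcons_inj[_ ->]].
  have [s1 [s2 [s3 [Es|Es]]]] := two_in_order zin inside (contra_neq (@esym _ _ _) bz).
  - have E' : cp e = (c1 ++ s1) ++ z :: s2 ++ b' :: (s3 ++ c3).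
      by rewrite cpE Es /= -!catA /= -catA.
    apply: (IH _ _ _ _ _ _ eH E') => //.
      by apply: shorter Es _ => -[zaE _]; rewrite zaE eqxx in za.
    by move=> s20; move: E' nu'; rewrite s20 => /(consecutive_used eH)/andP[->].
  - have E' : cp e = (c1 ++ s1) ++ b' :: s2 ++ z :: (s3 ++ c3).
      by rewrite cpE Es /= -!catA /= -catA.
    apply: (IH _ _ _ _ _ _ eH E') => //.
    + by apply: shorter Es _ => -[_ zbE]; rewrite zbE eqxx in zb.
    + by rewrite adj_sym.
    + by move=> s20; move: E' nu'; rewrite s20 => /(consecutive_used eH)/andP[_ ->].
case/mem_split: zc => k1 [k2 c2E].
have [bc1|bc1] := boolP (b' \in c1).
  case/mem_split: bc1 => h1 [h2 c1E].
  (* Crossing chords in the order [b'], [a], [z], [b]: one path follows the branch from [b'] to [a]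
     and then the chord [a b], the other takes the chord [b' z] and then follows the branch to [b].
     The vertices of [k1] are dropped. *)
  apply: Or32; exists e, h1, b', (h2 ++ a :: k1 ++ z :: k2), b, c3, (rcons h2 a), (z :: k2).
  have E' : cp e = h1 ++ b' :: (h2 ++ a :: k1 ++ z :: k2) ++ b :: c3.
    by rewrite E c1E c2E /= -!catA /= -!catA.
  have U' : uniq (h2 ++ a :: k1 ++ z :: k2).
    move: U; rewrite E' cat_uniq => /and3P[_ _] /= /andP[_].
    by rewrite cat_uniq => /andP[].
  split=> //; split; split=> //.
  - by case: (h2).
  - apply: subseq_uniq U'; rewrite cat_rcons; apply: cat_subseq => //=.
    by rewrite eqxx; apply: suffix_subseq.
  - move: P; rewrite E c1E -catA sorted_mid /= path_mid => /and3P[_ p1 _].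
    by rewrite rcons_path p1 last_rcons.
  - move: P; rewrite E'.
    rewrite sorted_mid -!catA /= -!catA path_mid => /and3P[_ _].
    by rewrite path_mid /= adj_sym pd => /andP[_]; rewrite path_mid => /andP[].
  - move=> t; rewrite !mem_cat mem_rcons !inE !mem_cat !inE.
    by case/orP=> /orP[->|->]; rewrite ?orbT.
have [h1 [h2 c3E]] : exists h1 h2, c3 = h1 ++ b' :: h2.
  by apply: mem_split; move: be; rewrite cpE !mem_cat (negPf bc1) (negPf outside).
(* The mirror case, in the order [a], [z], [b], [b']: from [a] to [z] along the branch and then the
   chord [z b'], or the chord [a b] and then the branch to [b']. Here [k2] is dropped. *)
apply: Or32; exists e, c1, a, (k1 ++ z :: k2 ++ b :: h1), b', h2, (rcons k1 z), (b :: h1).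
have E' : cp e = c1 ++ a :: (k1 ++ z :: k2 ++ b :: h1) ++ b' :: h2.
  by rewrite E c3E c2E /= -!catA /= -!catA.
have U' : uniq (k1 ++ z :: k2 ++ b :: h1).
  have := U; rewrite E' [uniq (c1 ++ _)]cat_uniq => /and3P[_ _] /= /andP[_].
  by rewrite [uniq ((k1 ++ _) ++ _)]cat_uniq => /andP[].
split=> //; split; split=> //.
- by case: (k1).
- apply: subseq_uniq U'; rewrite cat_rcons; apply: cat_subseq => //=.
  by rewrite eqxx; apply: suffix_subseq.
- move: pab; rewrite c2E rcons_cat rcons_cons path_mid => /andP[p1 _].
  by rewrite rcons_path p1 last_rcons.
- move: P; rewrite E c3E sorted_mid path_mid => /and3P[_ _].
  by rewrite path_mid /= ab => /andP[].
- move=> t; rewrite !mem_cat mem_rcons !inE !mem_cat !inE.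
  by case/orP=> /orP[->|->]; rewrite ?orbT.
Qed.

End Fixed.
End Ears.

(** * Growing a maximal embedding *)

Section Growth.
Variable G : sgraph.
Hypothesis conn2 : k_connected 2 G.
Hypothesis no_compliant : forall x y : G, ~ compliant x y.

Lemma conn_set0 : connected_off (set0 : {set G}).
Proof. by apply: (proj2 conn2); rewrite cards0. Qed.

Lemma exact_or_improvable H f g : wf H -> 1 < H.1 -> emb H f g ->
  exact_emb (G := G) H f g \/ improvable (G := G) H f g.
Proof.
move=> wH H2 fg.
have [/existsP[z /existsP[y /and3P[zI zy nu]]]|nex] := boolP
    [exists z, exists y, [&& z \in image H f g, adj z y & ~~ used_edge H f g z y]].
  right; have [d [b [[bI bz Ud D] [pd nu']]]] := ear_at conn2 H2 fg zI zy nu.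
  have [/hasP[e eH /andP[ze be]]|loc] :=
      boolP (has (fun e => (z \in closed_path f g e) && (b \in closed_path f g e)) H.2).
    have [d0|d0] := eqVneq d [::]; last first.
      by apply: (local_ear wH fg eH ze be bz _ Ud D pd); apply/eqP.
    rewrite d0 /= andbT in pd; move/(_ d0): nu' => nu'.
    have [s1 [s2 [s3 [E|E]]]] := two_in_order ze be (contra_neq (@esym _ _ _) bz).
      apply: (chord conn2 no_compliant wH H2 fg (leqnn _) eH E pd) => s20.
      by move: E nu'; rewrite s20 => /(consecutive_used eH)/andP[->].
    apply: (chord conn2 no_compliant wH H2 fg (leqnn _) eH E); first by rewrite adj_sym.
    by move=> s20; move: E nu'; rewrite s20 => /(consecutive_used eH)/andP[_ ->].
  apply: Or31; exists z, d, b; split=> //; split=> //; first by rewrite eq_sym.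
  by move=> e eH ze be; case/hasP: loc; exists e; rewrite ?ze.
left; have usd a b : a \in image H f g -> adj a b -> used_edge H f g a b.
  move=> aI ab; apply: contraR nex => nu; apply/existsP; exists a.
  by apply/existsP; exists b; rewrite aI ab.
have nxt a b : adj a b -> a \in image H f g -> b \in image H f g.
  move=> ab aI; have /hasP[e eH /edge_on_mem/andP[_ be]] := usd a b aI ab.
  exact: (cp_image wH eH be).
have all_im z : z \in image H f g.
  have f0 : f 0 \in image H f g by apply: f_image; rewrite ltnW.
  have := conn_set0; move=> /(_ (f 0) z); rewrite !inE => /(_ isT isT).
  move/(@closed_connect _ _ (mem (image H f g))) => E.
  rewrite -[z \in _]E //; move=> a b /= /and3P[ab _ _].
  by apply/idP/idP; apply: nxt => //; rewrite adj_sym.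
by split=> // a b; apply: usd.
Qed.

Lemma image_point H f g a : a \in image (G := G) H f g ->
  exists2 p, p \in points H & located H f g p a.
Proof.
rewrite mem_cat => /orP[/mapP[i iH ->]|/flattenP[s /mapP[e eH ->] ae]].
  exists (inl i); first by rewrite mem_cat map_f.
  by split=> //; rewrite mem_iota in iH.
by exists (inr e); rewrite // mem_cat (map_f inr eH) orbT.
Qed.

Lemma on_edge_cp H f g p (a : G) e : located H f g p a -> on_edge p e ->
  a \in closed_path f g e.
Proof.
rewrite /closed_path inE mem_rcons inE; case: p => [i|e'] /= [].
  by move=> _ <- /orP[]/eqP->; rewrite eqxx ?orbT.
by move=> _ ae /eqP<-; rewrite ae !orbT.
Qed.

Lemma nonlocal_ear_pair H f g : nonlocal_ear (G := G) H f g ->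
  exists p q a d b, [/\ (p, q) \in ear_pairs H, located H f g p a, located H f g q b & a != b] /\
  [/\ uniq d, {in d, forall z : G, z \notin image H f g} & path (@adj G) a (rcons d b)].
Proof.
case=> a [d [b [[aI bI ab loc] [Ud D pd]]]].
have [p pP pa] := image_point aI; have [q qP qb] := image_point bI.
have pq : p != q.
  apply: contra_neq ab => pq; subst q.
  case: p pa qb {pP qP} => [i|e] /= [eH ae] [_ be]; first by rewrite -ae.
  by case: (loc e eH); rewrite /closed_path inE mem_rcons inE ?ae ?be !orbT.
have ap p' q' a' b' : located H f g p' a' -> located H f g q' b' ->
    (forall e, e \in H.2 -> a' \in closed_path f g e -> b' \in closed_path f g e -> False) ->
    ~~ has (fun e => on_edge p' e && on_edge q' e) H.2.
  move=> la lb lc; apply/hasP => -[e eH /andP[pe qe]].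
  exact: (lc e eH (on_edge_cp la pe) (on_edge_cp lb qe)).
(* [ear_pairs] lists every pair in one order only, so the ear may have to be reversed. *)
have [lt|ge] := ltnP (index p (points H)) (index q (points H)).
  exists p, q, a, d, b; split=> //; split=> //.
  by rewrite mem_filter /= lt /apart pq (ap p q a b) //=; apply: allpairs_f.
exists q, p, b, (rev d), a; split; split=> //.
- rewrite mem_filter /apart /= eq_sym pq (ap q p b a) //=; last first.
    by move=> e eH be ae; apply: (loc e eH).
  rewrite ltn_neqAle ge andbT; apply/andP; split; last exact: allpairs_f.
  by apply: contra pq => /eqP E; rewrite -(nth_index p pP) -E nth_index.
- by rewrite eq_sym.
- by rewrite rev_uniq.
- by move=> z; rewrite mem_rev; apply: D.
- by rewrite -adj_path_rev.
Qed.

(** The image has at most [#|G|] vertices, so it can be enlarged only finitely often. *)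
Lemma improvement H (f : nat -> G) g : wf H -> 1 < H.1 -> emb H f g ->
  exists f' g', emb H f' g' /\
  [\/ exact_emb (G := G) H f' g', nonlocal_ear (G := G) H f' g' | bigon (G := G) H f' g'].
Proof.
move=> wH H2; have [n] := ubnP (#|G| - size (image H f g)).
elim: n f g => // n IH f g lt fg.
have [ex|[nl|bg|[f' [g' [fg' big]]]]] := exact_or_improvable wH H2 fg.
- by exists f, g; split=> //; apply: Or31.
- by exists f, g; split=> //; apply: Or32.
- by exists f, g; split=> //; apply: Or33.
apply: (IH f' g') => //; rewrite ltnS in lt; apply: leq_trans lt.
apply: ltn_sub2l => //; apply: leq_trans big _.
by rewrite -(card_uniqP (proj1 fg')) max_card.
Qed.

Lemma grow Fs Fs' H : wf H -> 1 < H.1 -> ears_ok Fs H -> bigons_ok Fs' H -> contains G H ->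
  (exists (f : nat -> G) g, emb H f g /\ exact_emb (G := G) H f g) \/
  exists2 F, F \in Fs ++ Fs' & contains G F.
Proof.
move=> wH H2 /allP okE /allP okB [f0 [g0 fg0]].
have [f [g [fg [ex|nl|bg]]]] := improvement wH H2 fg0.
- by left; exists f, g.
- right; have [p [q [a [d [b [[pq pa qb ab] [Ud D pd]]]]]]] := nonlocal_ear_pair nl.
  have ok := okE _ pq; have [wE _] := andP ok.
  have pnq : p != q by move: pq; rewrite mem_filter => /andP[/andP[/andP[]]].
  have := ear_ext_emb wH fg pa qb pnq wE Ud D pd ab.
  by case/(has_one_of_contains ok) => F FF cF; exists F; rewrite // mem_cat FF.
- right; case: bg => e [c1 [a [c2 [b [c3 [d1 [d2 [eH [[E n1 n2 U12] [p1 p2 D]]]]]]]]]].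
  have ok := okB e eH.
  have wB : all wf (bigon_exts H e) by apply: sub_all ok => H' /andP[].
  have [H' HB cH'] := bigon_ext_emb wH fg eH wB E n1 n2 U12 p1 p2 D.
  have [F FF cF] := has_one_of_contains (allP ok H' HB) cH'.
  by exists F; rewrite // mem_cat FF orbT.
Qed.

(** A branch with an interior vertex would exhibit a split of [H], so every embedding of [H] has
    bare branches and an image of [H.1] vertices. A bigon would then have [c2] empty, and one of its
    paths could widen the branch, contradicting this size. *)
Lemma rigid Fs H : wf H -> 1 < H.1 ->
  splits_ok Fs H -> chords_ok Fs H ->
  (forall F, F \in Fs -> ~ contains G F) -> contains G H ->
  exists (f : nat -> G) g,
    [/\ emb H f g, exact_emb (G := G) H f g & {in H.2, forall e, g e = [::]}].
Proof.
move=> wH H2 /allP okS /allP okE noF [f0 [g0 fg0]].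
have bare (f : nat -> G) g : emb H f g -> {in H.2, forall e, g e = [::] :> seq G}.
  move=> fg e eH; case E: (g e) => [//|z l]; exfalso.
  have cS : contains G (split_edge H e).
    by exists (split_f H f z), (split_g H g e [::] l); apply: split_emb.
  by have [F FF /(noF F FF)] := has_one_of_contains (okS e eH) cS.
have bare_size (f : nat -> G) g : emb H f g -> size (image (G := G) H f g) = H.1.
  move=> /bare gN; rewrite size_cat size_map size_iota.
  have -> : map g H.2 = map (fun=> [::]) H.2 by apply/eq_in_map => e; apply: gN.
  by elim: (H.2) => [|e s]; rewrite ?addn0.
have [f [g [fg [ex|nl|bg]]]] := improvement wH H2 fg0.
- by exists f, g; split=> //; apply: (bare f g fg).
- have [p [q [a [d [b [[pq pa qb ab] [Ud D pd]]]]]]] := nonlocal_ear_pair nl.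
  exfalso; have inlP p' a' : located H f g p' a' -> exists i, p' = inl i.
    by case: p' => [i _|e [eH]]; [exists i|rewrite (bare f g fg e eH)].
  have [i pE] := inlP _ _ pa; have [j qE] := inlP _ _ qb.
  have ok : has_one_of Fs (ear_ext H p q) by have := okE _ pq; rewrite pE qE.
  have [wE _] := andP ok.
  have pnq : p != q by move: pq; rewrite mem_filter => /andP[/andP[/andP[]]].
  have := ear_ext_emb wH fg pa qb pnq wE Ud D pd ab.
  by case/(has_one_of_contains ok) => F FF /(noF F FF).
- exfalso; case: bg => e [c1 [a [c2 [b [c3 [d1 [d2 [eH [[E n1 n2 U12] [p1 p2 D]]]]]]]]]].
  have c20 : c2 = [::].
    have := mid_interior (esym E); rewrite (bare f g fg e eH).
    by case: (c2) => // x s /(_ x (mem_head _ _)).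
  have [//|||f' [g' [fg']]] := widen wH fg eH _ n1 _ _ p1 (c1 := c1) (c3 := c3).
  - by rewrite E c20.
  - by move: U12; rewrite cat_uniq => /andP[].
  - move=> t td; apply/negP => /D; rewrite c20 mem_cat td => /(_ isT).
    by [].
  - by rewrite !bare_size // ltnn.
Qed.

End Growth.

(** * Recognizing the exact embeddings *)

Lemma simple_spec_inj H e e' : simple_spec H -> e \in H.2 -> e' \in H.2 ->
  same_ends e e' -> e = e'.
Proof.
have sym a b : same_ends a b = same_ends b a.
  rewrite /same_ends eq_sym; congr orb; rewrite (surjective_pairing a.1).
  by rewrite (surjective_pairing b.1) !xpair_eqE /src /tgt /= andbC ![_.1.1 == _]eq_sym
     ![_.1.2 == _]eq_sym.
rewrite /simple_spec; elim: (H.2) => //= a s IH /andP[/allP as_ ps].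
rewrite !inE => /predU1P[->|es] /predU1P[->|es'] //; last exact: IH.
- by move=> h; move: (as_ e' es'); rewrite h.
- by move=> h; move: (as_ e es); rewrite sym h.
Qed.

Section Recognize.
Variables (G K : sgraph) (H : spec) (idx : K -> nat) (f : nat -> G) (g : edge -> seq G).
Hypotheses (wH : wf H) (simple : simple_spec H) (fg : emb H f g) (ex : exact_emb H f g).
Hypothesis idx_inj : injective idx.
Hypothesis idx_lt : forall x, idx x < H.1.
Hypothesis idx_onto : forall i, i < H.1 -> exists x, idx x = i.
Hypothesis idx_adj : forall x y, adj x y = joined H (idx x) (idx y).

Lemma exact_isomorphic : {in H.2, forall e, g e = [::]} -> isomorphic G K.
Proof.
move=> bare; pose h x := f (idx x).
have hinj : injective h by move=> x y /(emb_inj fg (idx_lt x) (idx_lt y))/idx_inj.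
have hsurj z : z \in codom h.
  have := proj1 ex z; rewrite mem_cat => /orP[/mapP[i]|/flattenP[s /mapP[e eH ->]]].
    rewrite mem_iota => /idx_onto[x <-] ->; exact: codom_f.
  by rewrite bare.
exists (fun z => iinv (hsurj z)).
  exists h => [z|x]; first by rewrite f_iinv.
  by apply: hinj; rewrite f_iinv.
suff adjh x y : adj (h x) (h y) = adj x y.
  by move=> a b; rewrite -adjh !f_iinv.
apply/idP/idP => [/(proj2 ex)/hasP[e eH]|].
  rewrite /closed_path bare // /edge_on /steps /= !inE.
  have [sH tH _] := wf_edge wH eH.
  rewrite idx_adj; case/orP=> /eqP[/(emb_inj fg (idx_lt _) _) E1 /(emb_inj fg (idx_lt _) _) E2];
  apply/hasP; exists e => //.
    by rewrite E1 // E2 // -surjective_pairing eqxx.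
  by rewrite E1 // E2 // -surjective_pairing eqxx orbT.
rewrite idx_adj => /hasP[e eH]; have [+ _] := proj2 fg e eH; rewrite bare //= andbT.
by rewrite /src /tgt => + /orP[]/eqP E; rewrite E //= adj_sym.
Qed.

Lemma edge_atC u v : edge_at H u v = edge_at H v u.
Proof.
by rewrite /edge_at; congr head; apply: eq_filter => e; rewrite orbC.
Qed.

Let branch u v := f u :: rcons (oriented H g u v) (f v).

Lemma branchP u v : joined H u v -> let e := edge_at H u v in
  e.1 = (u, v) /\ branch u v = closed_path f g e \/
  e.1 = (v, u) /\ branch u v = rev (closed_path f g e).
Proof.
move=> uv e; have [eH] := edge_atP uv; rewrite -/e => ends.
have [_ _ st] := wf_edge wH eH.
rewrite /branch /oriented -/e /closed_path; case: ends => E; [left|right]; split=> //.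
  by rewrite E eqxx /src /tgt E.
rewrite E ifN; first by rewrite /src /tgt E rev_cons rev_rcons.
by move: st; rewrite /src /tgt -/e E xpair_eqE; apply: contra => /andP[].
Qed.

Lemma branch_mem u v z : joined H u v ->
  (z \in branch u v) = (z \in closed_path f g (edge_at H u v)).
Proof. by move/branchP=> [] [_ ->]; rewrite ?mem_rev. Qed.

Lemma branch_rev u v : joined H u v -> branch v u = rev (branch u v).
Proof.
move=> uv; have vu : joined H v u by rewrite joinedC.
have [eH _] := edge_atP uv; have [_ _ st] := wf_edge wH eH.
have uNv : u != v.
  by move: st; rewrite /src /tgt; case: (edge_atP uv) => _ [] -> //=; rewrite eq_sym.
have := branchP vu; rewrite edge_atC.
case: (branchP uv) => -[E ->] [] [E' ->]; rewrite ?revK //;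
by move: E' uNv; rewrite E => -[->]; rewrite eqxx.
Qed.

Lemma exact_subdivision : subdivision K G.
Proof.
have onto e : e \in H.2 -> exists x y, [/\ idx x = src e, idx y = tgt e & adj x y].
  move=> eH; have [sH tH _] := wf_edge wH eH.
  have [x ix] := idx_onto sH; have [y iy] := idx_onto tH; exists x, y; split=> //.
  by rewrite idx_adj ix iy; apply/hasP; exists e; rewrite // -surjective_pairing eqxx.
have at_e e : e \in H.2 -> joined H (src e) (tgt e) -> edge_at H (src e) (tgt e) = e.
  move=> eH j; have [eH' ends] := edge_atP j; apply: (simple_spec_inj simple) => //.
  rewrite /same_ends; case: ends => ->; rewrite -?surjective_pairing eqxx ?orbT //.
exists (fun x => f (idx x)), (fun x y => branch (idx x) (idx y)).
split; first by move=> x y /(emb_inj fg (idx_lt x) (idx_lt y))/idx_inj.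
split.
- move=> x y; rewrite idx_adj => xy; have [eH _] := edge_atP xy.
  have Ub : uniq (branch (idx x) (idx y)).
    by case: (branchP xy) => -[_ ->]; rewrite ?rev_uniq; apply: (cp_uniq wH fg eH).
  by rewrite /upath Ub /= eqxx last_rcons eqxx (oriented_path fg xy).
- by move=> x y; rewrite idx_adj; apply: branch_rev.
- move=> x y z; rewrite idx_adj => xy; rewrite branch_mem //.
  have [eH ends] := edge_atP xy; set e := edge_at _ _ _ in eH ends *.
  have [sH tH _] := wf_edge wH eH.
  have zN : f (idx z) \notin g e.
    apply/negP => zg; case: (fg) => + _; rewrite (perm_uniq (image_rem f g eH)).
    rewrite cat_uniq => /and3P[_ /hasP[]]; exists (f (idx z)).
      by rewrite mem_cat zg.
    by rewrite [_ \in _]map_f // mem_iota idx_lt.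
  rewrite inE mem_rcons inE (negPf zN) orbF.
  case/orP=> /eqP/(emb_inj fg (idx_lt z)) => [/(_ sH)|/(_ tH)]; rewrite /src /tgt.
    by case: ends => -> /= /idx_inj ->; [left|right].
  by case: ends => -> /= /idx_inj ->; [right|left].
- move=> x y x' y' z; rewrite !idx_adj => xy xy'; rewrite !branch_mem //.
  have [eH ends] := edge_atP xy; have [eH' ends'] := edge_atP xy'.
  move=> zc zc' zf; have zg : z \in g (edge_at H (idx x) (idx y)).
    move: zc; rewrite inE mem_rcons inE => /or3P[/eqP E|/eqP E|//];
    have [sH tH _] := wf_edge wH eH.
      by have [t it] := idx_onto sH; case: (zf t); rewrite it.
    by have [t it] := idx_onto tH; case: (zf t); rewrite it.
  have E := interior_unique wH fg eH eH' zg zc'; rewrite E in ends'.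
  by case: ends ends' => -> [] [/idx_inj-> /idx_inj->]; [left|right|right|left].
- split=> [z|a b /(proj2 ex)/hasP[e eH eo]].
    have := proj1 ex z; rewrite mem_cat => /orP[/mapP[i]|/flattenP[s /mapP[e eH ->] zg]].
      by rewrite mem_iota => /idx_onto[x <-] ->; left; exists x.
    have [x [y [ix iy xy]]] := onto e eH; right; exists x, y; split=> //.
    move: xy; rewrite idx_adj ix iy => xy; rewrite branch_mem // at_e //.
    by rewrite inE mem_rcons inE zg !orbT.
  have [x [y [ix iy xy]]] := onto e eH; exists x, y; split=> //.
  move: xy; rewrite idx_adj ix iy => xy.
  by case: (branchP xy) => -[_ ->]; rewrite at_e // edge_on_rev.
Qed.

End Recognize.

Section Exact.
Variable G : sgraph.

Lemma split_exact H (f : nat -> G) g e z l1 l2 :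
  wf H -> emb H f g -> e \in H.2 -> g e = l1 ++ z :: l2 -> exact_emb H f g ->
  exact_emb (split_edge H e) (split_f H f z) (split_g H g e l1 l2).
Proof.
move=> wH fg eH ge [im us]; have [sH tH _] := wf_edge wH eH.
split=> [t|a b ab]; first by rewrite (perm_mem (split_image f wH eH ge)).
have /hasP[e' eH' eo] := us a b ab.
have cpo : e' != e -> closed_path (split_f H f z) (split_g H g e l1 l2) e' = closed_path f g e'.
  have [sH' tH' _] := wf_edge wH eH'.
  by rewrite /closed_path split_g_old // !split_f_old.
have [ee|ne] := eqVneq e' e; last first.
  apply/hasP; exists e'; last by rewrite cpo.
  rewrite !inE mem_rem_uniq ?inE ?ne ?eH' ?orbT //.
  by case/andP: wH.
subst e'.
have fz : split_f H f z H.1 = z by rewrite /split_f eqxx.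
have c1 : closed_path (split_f H f z) (split_g H g e l1 l2) (src e, H.1, 0) =
    f (src e) :: rcons l1 z.
  by rewrite /closed_path split_g1 -[src (_, _, _)]/(src e) -[tgt (_, _, _)]/H.1 fz split_f_old.
have c2 : closed_path (split_f H f z) (split_g H g e l1 l2) (H.1, tgt e, 0) =
    z :: rcons l2 (f (tgt e)).
  by rewrite /closed_path split_g2 // -[tgt (_, _, _)]/(tgt e) -[src (_, _, _)]/H.1 fz
     (split_f_old f z tH).
suff [E|E] : edge_on (f (src e) :: rcons l1 z) a b \/ edge_on (z :: rcons l2 (f (tgt e))) a b.
- by apply/hasP; exists (src e, H.1, 0); rewrite ?c1 // mem_head.
- by apply/hasP; exists (H.1, tgt e, 0); rewrite ?c2 // !inE eqxx orbT.
have st (s1 s2 : seq G) x p : p \in steps (s1 ++ x :: s2) ->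
    p \in steps (rcons s1 x) \/ p \in steps (x :: s2).
  elim: s1 => [|y s1 IH]; first by right.
  case: s1 IH => [|y' s1] IH; rewrite /steps /= inE => /predU1P[->|].
  - by left; rewrite mem_head.
  - by right.
  - by left; rewrite mem_head.
  - by case/IH; [left; rewrite inE; apply/orP; right|right].
move: eo; rewrite /closed_path ge rcons_cat rcons_cons -cat_cons.
by rewrite /edge_on => /orP[] /st[] ->; rewrite ?orbT; [left|right|left|right].
Qed.

(** Recognition needs a simple spec, but [theta222] has parallel edges. Turning one interior vertex
    of each branch into a branch vertex yields the complete bipartite graph. *)
Lemma normalize_exact H (f : nat -> G) g : wf H -> emb H f g -> exact_emb H f g ->
  exists (f' : nat -> G) g', emb (normalize H) f' g' /\ exact_emb (normalize H) f' g'.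
Proof.
rewrite /normalize => wH.
have : uniq [seq e <- H.2 | 0 < tag e] by rewrite filter_uniq //; case/andP: wH.
have : {subset [seq e <- H.2 | 0 < tag e] <= H.2}.
  by move=> e; rewrite mem_filter => /andP[].
have : all (fun e => 0 < tag e) [seq e <- H.2 | 0 < tag e] by apply: filter_all.
move: [seq e <- H.2 | 0 < tag e] => s.
elim: s H f g wH => [|e s IH] H f g wH /=; first by exists f, g.
move=> /andP[te ts] sub /andP[es us] fg ex.
have eH : e \in H.2 by apply: sub; rewrite mem_head.
case: (proj2 fg e eH) => _ /(_ te); case E: (g e) => [//|z l] _.
apply: (IH _ (split_f H f z) (split_g H g e [::] l)) => //.
- exact: wf_split.
- move=> e' es'; rewrite !inE; apply/orP; right; apply/orP; right.
  rewrite mem_rem_uniq; last by case/andP: wH.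
  rewrite !inE sub ?inE ?es' ?orbT // andbT.
  by apply: contraNneq es => <-.
- exact: split_emb.
- exact: split_exact.
Qed.

End Exact.

(** * The initial theta graph *)

Lemma perm_theta (T : eqType) (c1 c2 c3 d : seq T) u v :
  perm_eq ([:: u; v] ++ (d ++ c2) ++ (c3 ++ c1)) (d ++ c1 ++ u :: c2 ++ v :: c3).
Proof.
change (perm_eq (([:: u] ++ [:: v]) ++ (d ++ c2) ++ (c3 ++ c1))
                (d ++ c1 ++ [:: u] ++ c2 ++ [:: v] ++ c3)).
apply/permP => q; rewrite !count_cat.
move: (count q _) (count q _) (count q _) (count q _) (count q _) (count q _).
by move=> *; lia.
Qed.

Section Start.
Variable G : sgraph.
Hypothesis conn2 : k_connected 2 G.
Hypothesis no_compliant : forall x y : G, ~ compliant x y.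

Lemma neighbor_off (S : {set G}) x y : #|S| < 2 -> x \notin S -> y \notin S -> x != y ->
  exists2 t, t \notin S & adj x t.
Proof.
move=> S2 xS yS xy; have /connectP[[|t p] /=] := proj2 conn2 S S2 x y xS yS.
  by move=> _ E; rewrite E eqxx in xy.
by case/andP=> /and3P[xt _ tS] _ _; exists t.
Qed.

(** A cycle through an edge [s t], viewed as two parallel branches so that the ear lemmas apply to
    it. *)
Definition cycle_spec : spec := (2, [:: (0, 1, 0); (0, 1, 1)]).

Lemma initial_theta : contains G theta122.
Proof.
have [G2 _] := conn2.
have pickN (S : {set G}) : #|S| < 3 -> exists x, x \notin S.
  move=> S3; have [/existsP[x xS]|nx] := boolP [exists x, x \notin S]; first by exists x.
  have : S = setT.
    apply/setP => x; rewrite inE; apply: contraR nx => xS.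
    by apply/existsP; exists x.
  move=> ST; move: G2 S3; rewrite ST cardsT => h1 h2.
  by move: (leq_trans h2 h1); rewrite ltnn.
have [s _] : exists s : G, s \notin set0 by apply: pickN; rewrite cards0.
have [s' ss] : exists s', s' \notin [set s] by apply: pickN; rewrite cards1.
have [t _ st] : exists2 t, t \notin set0 & adj s t.
  apply: (@neighbor_off set0 s s'); rewrite ?cards0 ?inE //.
  by move: ss; rewrite inE eq_sym.
have sNt : s != t by apply: contraTneq st => ->; rewrite adj_irr.
have [u uN] : exists u, u \notin [set s; t] by apply: pickN; rewrite cards2 sNt.
have [y yt sy] : exists2 y, y \notin [set t] & adj s y.
  apply: (@neighbor_off [set t] s u); rewrite ?cards1 ?inE //.
    by move: uN; rewrite !inE negb_or => /andP[].
  by move: uN; rewrite !inE negb_or eq_sym => /andP[].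
have tS : t \in [:: s; t] by rewrite !inE eqxx orbT.
have ts : t != s by rewrite eq_sym.
have yS : y \notin [:: s; t].
  rewrite !inE negb_or; move: yt; rewrite inE => ->; rewrite andbT.
  by apply: contraTneq sy => ->; rewrite adj_irr.
have [d [b [[bS bs d0 Ud D] pd]]] := ear_from conn2 tS ts (mem_head s [:: t]) yS sy.
have {bS bs} bt : b = t by move: bS; rewrite !inE (negPf bs) => /eqP.
subst b.
have [z zd dz] : exists2 z, z \in d & degree z != 2.
  apply/hasP; rewrite -[has _ _]negbK -all_predC; apply/negP => /allP flat.
  apply: (@no_compliant s t); split=> //; exists (s :: rcons d t); last first.
    by case: (d) d0 => // x [].
  split.
    rewrite /upath /= eqxx last_rcons eqxx pd /= mem_rcons inE negb_or sNt rcons_uniq Ud.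
    by rewrite !(contraL (@D _)) // !inE eqxx ?orbT.
  move=> w; rewrite inE mem_rcons inE => /or3P[/eqP->|/eqP->|/flat]; rewrite ?eqxx //=.
  by rewrite negbK => /eqP.
pose f i := if i == 0 then s else t.
pose g (e : edge) := if e == (0, 1, 1) then d else [::].
have imE : image cycle_spec f g = [:: s, t & d] by rewrite /image /= cats0.
have fg : emb cycle_spec f g.
  split; last first.
    by move=> e; rewrite !inE => /orP[]/eqP->; rewrite /f /g /src /tgt //= st.
  rewrite imE /= inE negb_or sNt Ud andbT /=.
  by rewrite !(contraL (@D _)) // !inE eqxx ?orbT.
have wC : wf cycle_spec by [].
have eC : ((0, 1, 1) : edge) \in cycle_spec.2 by [].
have [y' zy' nu] := unused_at_interior wC fg eC zd dz.
have zI : z \in image cycle_spec f g by rewrite imE !inE zd !orbT.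
have [d' [b [[bI bz Ud' D'] [pd' nu']]]] := ear_at conn2 (isT : 1 < cycle_spec.1) fg zI zy' nu.
pose C := s :: rcons d t.
have CE : closed_path f g (0, 1, 1) = C by [].
have imC x : (x \in image cycle_spec f g) = (x \in C).
  by rewrite imE !inE mem_rcons inE.
have zC : z \in C by rewrite -imC.
have bC : b \in C by rewrite -imC.
have UC : uniq C by apply: (cp_uniq wC fg eC).
have PC : sorted (@adj G) C by apply: (cp_sorted fg eC).
have zs : z != s by apply: contraTneq zd => ->; apply/negP => /D; rewrite mem_head.
have zt : z != t by apply: contraTneq zd => ->; apply/negP => /D; rewrite !inE eqxx orbT.
have build c1 u' c2 v' c3 d1 : C = c1 ++ u' :: c2 ++ v' :: c3 ->
    (z == u') || (z == v') -> uniq d1 -> {in d1, forall x, x \notin C} ->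
    path (@adj G) u' (rcons d1 v') -> (d1 = [::] -> c2 <> [::]) -> contains G theta122.
  move=> CE' zuv U1 D1 p1 ne.
  (* [c3 ++ c1] is the arc that passes through the edge [t s]. One of its ends is [z], which is
     neither [s] nor [t], so the arc is longer than that edge. *)
  have n3 : c3 ++ c1 <> [::].
    case: c3 CE' => // CE' /= c10; move: CE'; rewrite c10 /= cats1 => -[su /rcons_inj[_ tv]].
    by move: zuv; rewrite -su -tv (negPf zs) (negPf zt).
  have p2 : path (@adj G) u' (rcons c2 v').
    by move: PC; rewrite CE' sorted_mid path_mid => /and3P[].
  have p3 : path (@adj G) v' (rcons (c3 ++ c1) u').
    move: PC; rewrite CE' sorted_mid path_mid => /and3P[q1 _ q2].
    rewrite rcons_cat cat_path q2.
    have -> : last v' c3 = t.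
      by have := congr1 (last s) CE'; rewrite /C /= last_rcons last_cat /= last_cat /= => ->.
    have [w Ew] : exists w, rcons c1 u' = s :: w.
      case: (c1) CE' => [|x c1']; first by case=> -> _; exists [::].
      by case=> -> _; exists (rcons c1' u').
    by move: q1; rewrite Ew /= adj_sym st.
  have U3 : uniq ([:: u'; v'] ++ (d1 ++ c2) ++ (c3 ++ c1)).
    have pm : perm_eq ([:: u'; v'] ++ (d1 ++ c2) ++ (c3 ++ c1)) (d1 ++ C).
      by rewrite CE'; apply: perm_theta.
    rewrite (perm_uniq pm) cat_uniq U1 UC !andbT; apply/hasPn => x xC.
    by apply/negP => /D1; rewrite xC.
  have [e0|e0] := eqVneq d1 [::].
    exists (fun i => if i == 0 then u' else v'),
      (fun e => if e == (1, 0, 1) then c3 ++ c1 else if e == (0, 1, 1) then c2 else [::]).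
    split; first by move: U3; rewrite e0 /image /= cats0.
    move=> e; rewrite !inE => /or3P[]/eqP->; rewrite /src /tgt //=; split=> //.
    - by move: p1; rewrite e0.
    - by move=> _; apply: ne.
  pose f' i := if i == 0 then u' else v'.
  pose g' (e : edge) :=
    if e == (1, 0, 1) then c3 ++ c1 else if e == (0, 1, 1) then d1 else c2.
  exists f', g'; split.
    have pm : perm_eq (image theta122 f' g') ([:: u'; v'] ++ (d1 ++ c2) ++ (c3 ++ c1)).
      by rewrite /image /= cats0 !perm_cons catA perm_cat2r perm_catC.
    by rewrite (perm_uniq pm).
  move=> e; rewrite !inE => /or3P[]/eqP->; rewrite /src /tgt //=; split=> //.
  by move=> _; apply/eqP.
have D'C : {in d', forall x, x \notin C} by move=> x /D'; rewrite imC.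
have [s1 [s2 [s3 [E|E]]]] := two_in_order zC bC (contra_neq (@esym _ _ _) bz).
  apply: (build _ _ _ _ _ d' E) => //; first by rewrite eqxx.
  move=> e0 s20; move/(_ e0): nu'; rewrite -CE s20 in E.
  by case/andP: (consecutive_used eC E) => ->.
apply: (build _ _ _ _ _ (rev d') E); first by rewrite eqxx orbT.
- by rewrite rev_uniq.
- by move=> x; rewrite mem_rev; apply: D'C.
- by rewrite -adj_path_rev.
move=> e0 s20; have {}e0 : d' = [::] by rewrite -(revK d') e0.
move/(_ e0): nu'; rewrite -CE s20 in E.
by case/andP: (consecutive_used eC E) => _ ->.
Qed.

End Start.

(** * Vertex numberings of the target graphs and the final case analysis *)

Definition wheel_idx n (x : option 'I_n) : nat := if x is Some i then i : nat else n.
Definition bip_idx m n (x : 'I_m + 'I_n) : nat :=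
  match x with inl i => i | inr j => m + j end.

Lemma wheel_idx_inj n : injective (@wheel_idx n).
Proof.
move=> [i|] [j|] //= E; first by congr Some; apply: val_inj.
  by move: (ltn_ord i); rewrite E ltnn.
by move: (ltn_ord j); rewrite -E ltnn.
Qed.

Lemma wheel_idx_lt n x : @wheel_idx n x < n.+1.
Proof. by case: x => [i|] //=; rewrite ltnS ltnW. Qed.

Lemma wheel_idx_onto n i : i < n.+1 -> exists x, @wheel_idx n x = i.
Proof.
rewrite ltnS leq_eqVlt => /predU1P[->|iH]; first by exists None.
by exists (Some (Ordinal iH)).
Qed.

Lemma ord_onto n i : i < n -> exists x : 'I_n, x = i :> nat.
Proof. by move=> iH; exists (Ordinal iH). Qed.

Lemma bip_idx_inj m n : injective (@bip_idx m n).
Proof.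
move=> [i|i] [j|j] /= E.
- by congr inl; apply: val_inj.
- by move: (ltn_ord i); rewrite E ltnNge leq_addr.
- by move: (ltn_ord j); rewrite -E ltnNge leq_addr.
- by congr inr; apply/val_inj/(addnI E).
Qed.

Lemma bip_idx_lt m n x : @bip_idx m n x < m + n.
Proof. by case: x => i /=; [apply: ltn_addr|rewrite ltn_add2l]. Qed.

Lemma bip_idx_onto m n i : i < m + n -> exists x, @bip_idx m n x = i.
Proof.
move=> iH; have [im|im] := ltnP i m; first by exists (inl (Ordinal im)).
have jH : i - m < n by rewrite ltn_subLR.
by exists (inr (Ordinal jH)); rewrite /= subnKC.
Qed.

(** By exactness, interior vertices of branches have degree two. If the unbounded branch were a
    single edge, any other branch would be a flat path making it compliant; so all three branches
    have length at least two. *)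
Lemma exact_theta122 (G : sgraph) (f : nat -> G) g :
  (forall x y : G, ~ compliant x y) ->
  emb theta122 f g -> exact_emb theta122 f g -> contains G theta222.
Proof.
move=> nc fg ex.
have e0 : ((0, 1, 0) : edge) \in theta122.2 by [].
have e1 : ((0, 1, 1) : edge) \in theta122.2 by [].
have e2 : ((1, 0, 1) : edge) \in theta122.2 by [].
have [p0 _] := proj2 fg _ e0; have [p1 n1] := proj2 fg _ e1; have [p2 n2] := proj2 fg _ e2.
have [g0|g0] := eqVneq (g (0, 1, 0)) [::].
  case: (nc (f 0) (f 1)); split; first by move: p0; rewrite g0 /= andbT.
  exists (closed_path f g (0, 1, 1)); last first.
    by rewrite /closed_path; case: (g _) (n1 isT) => // x [].
  split.
    have U := cp_uniq (isT : wf theta122) fg e1.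
    by rewrite /upath U /= eqxx last_rcons eqxx p1.
  move=> z; rewrite inE mem_rcons inE => /or3P[/eqP->|/eqP->|zg _ _]; rewrite ?eqxx //.
  apply/eqP; apply/negPn/negP => /(unused_at_interior (isT : wf theta122) fg e1 zg).
  by case=> y /(proj2 ex) ->.
exists f, (fun e => if e == (0, 1, 2) then g (0, 1, 0) else g e); split.
  set g' := fun e => _.
  have pm : perm_eq (image theta222 f g') (image theta122 f g).
    by rewrite /image /= !cats0 !perm_cons perm_catCA.
  by rewrite (perm_uniq pm); case: fg.
by move=> e; rewrite !inE => /or3P[]/eqP->; split=> //= _; apply/eqP.
Qed.

Theorem theorem2 (R : realType) (G : sgraph) :
  k_connected 2 G ->
  strictly_metrizable R G ->
  (forall x y : G, ~ compliant x y) ->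
  isomorphic G (complete 5) \/
  isomorphic G (wheel 5) \/
  subdivision (complete_bipartite 2 3) G \/
  subdivision (complete 4) G \/
  subdivision (wheel 4) G \/
  subdivision wheel4' G.
Proof.
move=> conn2 sm nc.
have no_bad F : F \in bad -> ~ contains G F.
  by move=> FB cF; apply: (bad_not_metrizable (conn_set0 conn2) FB cF sm).
have no_bigon F : F \in bad_bigons -> ~ contains G F.
  by move=> FB; apply: no_bad; move: FB; rewrite !inE => /or3P[]->; rewrite ?orbT.
set goal := _ \/ _.
(* The implications run from the largest graphs downwards, so that growing a graph always leads to a
   case already settled. *)
have hasK5 : contains G K5 -> goal.
  move=> cH; left.
  have [f [g [fg ex bare]]] := rigid conn2 nc (H := K5) isT isT K5_splits K5_chords no_bad cH.
  apply: (exact_isomorphic (H := K5) (idx := fun x : complete 5 => x : nat) isT fg ex) bare.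
  - exact: val_inj.
  - exact: ltn_ord.
  - exact: ord_onto.
  - by move=> [[|[|[|[|[|x]]]]] Hx] [[|[|[|[|[|y]]]]] Hy].
have hasW5 : contains G W5 -> goal.
  move=> cH; right; left.
  have [f [g [fg ex bare]]] := rigid conn2 nc (H := W5) isT isT W5_splits W5_chords no_bad cH.
  apply: (exact_isomorphic (H := W5) (K := wheel 5) (idx := @wheel_idx 5) isT fg ex) bare.
  - exact: wheel_idx_inj.
  - exact: wheel_idx_lt.
  - exact: wheel_idx_onto.
  - by move=> [[[|[|[|[|[|x]]]]] Hx]|] [[[|[|[|[|[|y]]]]] Hy]|].
have hasW4' : contains G W4' -> goal.
  move=> cH; have [[f [g [fg ex]]]|[F]] :=
    grow conn2 nc (H := W4') isT isT W4'_ears W4'_bigons cH.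
    do 5!right.
    apply: (exact_subdivision (H := W4') (K := wheel4') (idx := @wheel_idx 4) isT isT fg ex).
    - exact: wheel_idx_inj.
    - exact: wheel_idx_lt.
    - exact: wheel_idx_onto.
    - by move=> [[[|[|[|[|x]]]] Hx]|] [[[|[|[|[|y]]]] Hy]|].
  rewrite mem_cat => /orP[|FB /(no_bigon F FB)//].
  by rewrite !(in_cons K5, in_cons W5) => /or3P[/eqP->|/eqP->|FB /(no_bad F FB)].
have hasW4 : contains G W4 -> goal.
  move=> cH; have [[f [g [fg ex]]]|[F]] :=
    grow conn2 nc (H := W4) isT isT W4_ears W4_bigons cH.
    do 4!right; left.
    apply: (exact_subdivision (H := W4) (K := wheel 4) (idx := @wheel_idx 4) isT isT fg ex).
    - exact: wheel_idx_inj.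
    - exact: wheel_idx_lt.
    - exact: wheel_idx_onto.
    - by move=> [[[|[|[|[|x]]]] Hx]|] [[[|[|[|[|y]]]] Hy]|].
  rewrite mem_cat => /orP[|FB /(no_bigon F FB)//].
  by rewrite !(in_cons W4', in_cons W5) => /or3P[/eqP->|/eqP->|FB /(no_bad F FB)].
have hasK4 : contains G K4 -> goal.
  move=> cH; have [[f [g [fg ex]]]|[F]] :=
    grow conn2 nc (H := K4) isT isT K4_ears K4_bigons cH.
    do 3!right; left.
    apply: (exact_subdivision (H := K4) (idx := fun x : complete 4 => x : nat) isT isT fg ex).
    - exact: val_inj.
    - exact: ltn_ord.
    - exact: ord_onto.
    - by move=> [[|[|[|[|x]]]] Hx] [[|[|[|[|y]]]] Hy].
  rewrite mem_cat => /orP[|FB /(no_bigon F FB)//].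
  rewrite (in_cons W4) => /predU1P[->//|FB].
  by move/no_bad; case; move: FB; rewrite !inE => /orP[]->; rewrite ?orbT.
have has222 : contains G theta222 -> goal.
  move=> cH; have [[f0 [g0 [fg0 ex0]]]|[F]] :=
    grow conn2 nc (H := theta222) isT isT theta222_ears theta222_bigons cH.
    have [f [g [fg ex]]] := normalize_exact (H := theta222) isT fg0 ex0.
    do 2!right; left.
    apply: (exact_subdivision (H := normalize theta222) (K := complete_bipartite 2 3)
      (idx := @bip_idx 2 3) isT isT fg ex).
    - exact: bip_idx_inj.
    - exact: bip_idx_lt.
    - by move=> i iH; apply: (@bip_idx_onto 2 3 i iH).
    - by move=> [[[|[|x]] Hx]|[[|[|[|x]]] Hx]] [[[|[|y]] Hy]|[[|[|[|y]]] Hy]].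
  rewrite mem_cat => /orP[|FB /(no_bigon F FB)//].
  by rewrite mem_seq1 => /eqP->.
have [[f [g [fg ex]]]|[F]] :=
    grow conn2 nc (H := theta122) isT isT theta122_ears theta122_bigons (initial_theta conn2 nc).
  exact: has222 (exact_theta122 nc fg ex).
(* A bigon on [theta122] produces [K23], which is fed back as a theta graph with three long
   branches. *)
rewrite (in_cons K4) mem_seq1 => /orP[/eqP->//|/eqP-> cK].
exact: has222 (has_minor_contains theta222_in_K23 cK).
Qed.
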